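(* Let $G$ be a locally compact, totally disconnected Hausdorff group and let $H\le G$ be a closed subgroup, with both $G$ and $H$ unimodular. Assume there exists a continuous anti-involution $\sigma:G\to G$ such that $\sigma(H)=H$ and $\sigma(\xi)=\xi$ for every generalized function $\xi\in C^{-\infty}(G)^{H\times H}$. Then the Hecke algebra $\mathcal H:=\mathrm{End}_G(\mathrm{ind}_H^G 1)$ is commutative.
   Context: An anti-involution is a map $\sigma:G\to G$ with $\sigma(g_1g_2)=\sigma(g_2)\sigma(g_1)$ for all $g_1,g_2\in G$ and $\sigma^2=\mathrm{Id}$. $C^{-\infty}(G)$ is the space of generalized functions on $G$, i.e. the full linear dual of the space of all locally constant, compactly supported complex measures on $G$ (locally constant compactly supported functions times a Haar measure). $C^{-\infty}(G)^{H\times H}$ is the subspace of those generalized functions invariant under left and right translations by $H$. $\sigma$ acts on generalized functions by $\langle \sigma(\xi),m\rangle=\langle \xi,\sigma_*m\rangle$. $\mathrm{ind}_H^G 1$ is the space of functions $f:G\to\mathbb C$ with $f(hg)=f(g)$ for $h\in H$, invariant under right translation by some open subgroup, and with support compact modulo $H$; $G$ acts by $(g'\cdot f)(g)=f(gg')$. $\mathrm{End}_G$ denotes the algebra of $G$-equivariant linear endomorphisms under composition. *)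

(* Defs.v *)
From HB Require Import structures.
From mathcomp Require Import all_boot all_order all_algebra.
From mathcomp Require Import all_classical all_reals all_analysis.
From mathcomp Require Import measurable_realfun complex.

Set Implicit Arguments.
Unset Strict Implicit.
Unset Printing Implicit Defensive.

Import Order.TTheory GRing.Theory Num.Theory.
Import numFieldNormedType.Exports.

Local Open Scope classical_set_scope.
Local Open Scope ring_scope.

HB.mixin Record Topological_isTopologicalGroup G
    & Topological G & Group G := {
  mulg_continuous : continuous (fun x : G * G => (x.1 * x.2)%g);
  invg_continuous : continuous (fun x : G => x^-1%g)
}.

#[short(type="topologicalGroupType")]
HB.structure Definition TopologicalGroup :=
  {G of Topological G & Group G & Topological_isTopologicalGroup G}.

Section continuity.
Variable G : topologicalGroupType.

Lemma continuousMg (T : topologicalType) (f g : T -> G) :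
  continuous f -> continuous g -> continuous (fun x => (f x * g x)%g).
Proof.
move=> cf cg x; apply: (@continuous_comp _ _ _ (fun x => (f x, g x))
  (fun u : G * G => (u.1 * u.2)%g)); last exact: mulg_continuous.
by apply: cvg_pair; [exact: cf|exact: cg].
Qed.

Lemma continuousVg (T : topologicalType) (f : T -> G) :
  continuous f -> continuous (fun x => (f x)^-1%g).
Proof.
by move=> cf x; apply: continuous_comp; [exact: cf|exact: invg_continuous].
Qed.

Lemma continuous_cstg (T : topologicalType) (a : G) : continuous (fun _ : T => a).
Proof. by move=> x; exact: cvg_cst. Qed.

Lemma continuous_idg : continuous (fun x : G => x).
Proof. by move=> x; exact: cvg_id. Qed.

End continuity.

(* A subgroup as a topological group in its own right, with the topology
   induced by the ambient group. *)
Definition subgroup_type (G : topologicalGroupType) (H : groupClosed G) :=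
  {x : G | x \in H}.

Section subgroup_type.
Variables (G : topologicalGroupType) (H : groupClosed G).

HB.instance Definition _ := [isSub of subgroup_type H for @sval _ _].
HB.instance Definition _ := [Choice of subgroup_type H by <:].

Fact subgroup_group_closed : group_closed (mem H : {pred G}).
Proof. by split=> [|x y]; [exact: gpred1|exact: gpredF]. Qed.

HB.instance Definition _ :=
  SubChoice_isSubGroup.Build G _ (subgroup_type H) subgroup_group_closed.
HB.instance Definition _ := Topological.copy (subgroup_type H)
  (initial_topology (val : subgroup_type H -> G)).

Lemma val_subgroup_continuous : continuous (val : subgroup_type H -> G).
Proof. exact: initial_continuous. Qed.

Fact subgroup_mulg_continuous : continuous
  (fun x : subgroup_type H * subgroup_type H => (x.1 * x.2)%g).
Proof.
apply: continuous_comp_initial.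
rewrite (_ : _ \o _ = fun x => (val x.1 * val x.2)%g)//.
apply: continuousMg => x; apply: continuous_comp;
  by [exact: cvg_fst|exact: cvg_snd|exact: val_subgroup_continuous].
Qed.

Fact subgroup_invg_continuous : continuous (fun x : subgroup_type H => x^-1%g).
Proof.
apply: continuous_comp_initial.
rewrite (_ : _ \o _ = fun x => ((val x)^-1)%g)//.
exact/continuousVg/val_subgroup_continuous.
Qed.

HB.instance Definition _ := Topological_isTopologicalGroup.Build
  (subgroup_type H) subgroup_mulg_continuous subgroup_invg_continuous.

End subgroup_type.

Definition borel (G : Type) : Type := G.

Section borel.
Variable G : topologicalGroupType.

HB.instance Definition _ := Choice.on (borel G).
(* The library only puts measurable structures on pointed types. *)
HB.instance Definition _ := isPointed.Build (borel G) (1%g : G).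
HB.instance Definition _ := @isMeasurable.Build (sigma_display (@open G))
  (borel G) <<s @open G >> (@sigma_algebra0 _ setT (@open G))
  (@sigma_algebraC (borel G) (@open G))
  (@sigma_algebra_bigcup _ setT (@open G)).

End borel.

Section haar.
Variables (R : realType) (G : topologicalGroupType).
Implicit Type nu : {measure set (borel G) -> \bar R}.

Definition radon nu :=
  [/\ forall K : set G, compact K -> (nu K < +oo)%E,
      forall A : set (borel G), measurable A ->
        nu A = ereal_inf [set nu U | U in [set U : set G | open U /\ A `<=` U]] &
      forall U : set G, open U ->
        nu U = ereal_sup [set nu K | K in [set K : set G | compact K /\ K `<=` U]]].

Definition left_invariant nu := forall (g : G) (A : set (borel G)),
  measurable A -> nu [set x : G | A (g * x)%g] = nu A.

Definition right_invariant nu := forall (g : G) (A : set (borel G)),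
  measurable A -> nu [set x : G | A (x * g)%g] = nu A.

Definition left_haar nu := [/\ radon nu, nu setT != 0%E & left_invariant nu].

Definition right_haar nu := [/\ radon nu, nu setT != 0%E & right_invariant nu].

Definition haar nu := left_haar nu \/ right_haar nu.

(* On a locally compact group a left Haar measure exists and is unique up to
   scaling, so one of them is right invariant if and only if all of them are. *)
Definition unimodular :=
  exists nu : {measure set (borel G) -> \bar R},
    left_haar nu /\ right_invariant nu.

End haar.

Definition locally_constant (T : topologicalType) (V : Type) (f : T -> V) :=
  forall x, \forall y \near x, f y = f x.

Lemma open_locally_constant (T : topologicalType) (V : Type) (f : T -> V)
  (B : set V) : locally_constant f -> open (f @^-1` B).
Proof. by move=> lf; rewrite openE => x Bx; apply: filterS (lf x) => y /= ->. Qed.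

Definition test_function (R : realType) (G : topologicalGroupType)
    (f : G -> R[i]) :=
  locally_constant f /\ compact (closure [set x | f x != 0]).

Definition borel_set (G : topologicalGroupType) :=
  {A : set (borel G) | measurable A}.

Section smooth_measure.
Variables (R : realType) (G : topologicalGroupType).

(* A complex measure is given by its values on the Borel sets. *)
Local Notation set_function := (borel_set G -> R[i]^o).

Definition density (f : G -> R[i])
    (nu : {measure set (borel G) -> \bar R}) : set_function := fun A =>
  Complex (\int[nu]_(x in sval A) complex.Re (f x))
          (\int[nu]_(x in sval A) complex.Im (f x)).

(* The linear span of the measures f nu. By uniqueness of Haar measures, each
   element is of the form f nu for an arbitrary fixed nu; taking the span
   avoids the choice of nu. *)
Definition is_smooth (m : set_function) :=
  exists n (a : 'I_n -> R[i]) (f : 'I_n -> G -> R[i])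
      (nu : 'I_n -> {measure set (borel G) -> \bar R}),
    (forall i, test_function (f i) /\ haar (nu i)) /\
    m = \sum_i a i *: density (f i) (nu i).

Definition smooth_pred : {pred set_function} := fun m => `[< is_smooth m >].

Record smooth_measure :=
  SmoothMeasure { smooth_val : set_function ; _ : smooth_val \in smooth_pred }.

HB.instance Definition _ := [isSub for smooth_val].
HB.instance Definition _ := [Choice of smooth_measure by <:].

Fact smooth_submod_closed : submod_closed smooth_pred.
Proof.
split=> [|c u v /asboolP[n [a [f [nu [h ->]]]]]
  /asboolP[n' [a' [f' [nu' [h' ->]]]]]]; apply/asboolP.
  exists 0%N, (fun=> 0), (fun=> cst 0), (fun=> mzero).
  by split=> [[]//|]; rewrite big_ord0.
pose c2 T (x : 'I_n -> T) y (i : 'I_(n + n')) :=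
  match fintype.split i with inl j => x j | inr j => y j end.
exists (n + n')%N, (c2 _ (fun i => c * a i) a'), (c2 _ f f'), (c2 _ nu nu').
split=> [i|]; first by rewrite /c2; case: fintype.splitP.
rewrite big_split_ord/= scaler_sumr; congr (_ + _); apply: eq_bigr => i _.
  by rewrite /c2 -[lshift _ _]/(unsplit (inl i)) unsplitK scalerA.
by rewrite /c2 -[rshift _ _]/(unsplit (inr i)) unsplitK.
Qed.

HB.instance Definition _ := GRing.isSubmodClosed.Build R[i] set_function
  smooth_pred smooth_submod_closed.
HB.instance Definition _ := [SubChoice_isSubLmodule of smooth_measure by <:].

Definition generalized_function := {linear smooth_measure -> R[i]^o}.

End smooth_measure.

Section borel_preimage.
Variables (G : topologicalGroupType) (phi : G -> G).
Hypothesis cphi : continuous phi.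

Lemma borel_measurable_continuous :
  measurable_fun setT (phi : borel G -> borel G).
Proof.
apply: (@measurability _ _ (borel G) (borel G) _ _ (@open G)) => //.
move=> _ [U oU <-]; rewrite setTI.
apply: sub_sigma_algebra.
by move/continuousP: cphi; exact.
Qed.

Fact borel_preimage_subproof (A : borel_set G) :
  measurable (phi @^-1` sval A : set (borel G)).
Proof.
by rewrite -[X in measurable X]setTI; exact: borel_measurable_continuous (svalP A).
Qed.

Definition borel_preimage (A : borel_set G) : borel_set G :=
  exist _ _ (borel_preimage_subproof A).

End borel_preimage.

Section pushforward.
Variables (R : realType) (G : topologicalGroupType).
Variables (phi psi : G -> G).
Hypotheses (cphi : continuous phi) (cpsi : continuous psi).
Hypotheses (phiK : cancel phi psi) (psiK : cancel psi phi).
Implicit Type nu : {measure set (borel G) -> \bar R}.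

Let mphi := borel_measurable_continuous cphi.

Definition push nu : {measure set (borel G) -> \bar R} :=
  measure_function_pushforward__canonical__measure_function_Measure nu mphi.

Lemma measurable_open (U : set G) : open U -> measurable (U : set (borel G)).
Proof. exact: sub_sigma_algebra. Qed.

Let image_preimage (A : set G) : phi @` A = psi @^-1` A.
Proof.
by apply/seteqP; split=> [_ [x Ax <-]|x Ax] /=; [rewrite phiK|exists (psi x)].
Qed.

Let preimage_image (A : set G) : psi @` A = phi @^-1` A.
Proof.
by apply/seteqP; split=> [_ [x Ax <-]|x Ax] /=; [rewrite psiK|exists (phi x)].
Qed.

Lemma radon_pushforward nu : radon nu ->
  radon (push nu).
Proof.
case=> fnu onu inu; split=> [K cK|A mA|U oU]; rewrite /push /= /pushforward.
- apply: fnu; rewrite -preimage_image; apply: continuous_compact => //.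
  exact/continuous_subspaceT.
- rewrite onu; last by rewrite -[X in measurable X]setTI; exact: mphi.
  congr ereal_inf; apply/seteqP; split=> _ [U [oU AU] <-].
    exists (psi @^-1` U); last first.
      by congr (nu _); apply/seteqP; split=> x; rewrite /= phiK.
    split; first by move/continuousP: cpsi; exact.
    by move=> x Ax /=; apply: AU; rewrite /= psiK.
  exists (phi @^-1` U) => //; split; first by move/continuousP: cphi; exact.
  by move=> x /AU.
- rewrite inu; last by move/continuousP: cphi; exact.
  congr ereal_sup; apply/seteqP; split=> _ [K [cK KU] <-].
    exists (phi @` K).
      split; last by move=> _ [x /KU Ux <-].
      by apply: continuous_compact => //; exact/continuous_subspaceT.
    by congr (nu _); apply/seteqP; split=> [x [y Ky /(can_inj phiK) <-//]|x Kx];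
      exists x.
  exists (phi @^-1` K) => //; split; last by move=> x /KU.
  rewrite -preimage_image; apply: continuous_compact => //.
  exact/continuous_subspaceT.
Qed.

Lemma test_function_comp (f : G -> R[i]) :
  test_function f -> test_function (f \o psi).
Proof.
case=> lf cf; split=> [x|]; first exact: cpsi (lf (psi x)).
have /subclosed_compact : compact (phi @` closure [set x | f x != 0]).
  by apply: continuous_compact => //; exact/continuous_subspaceT.
apply; first exact: closed_closure.
have -> : phi @` closure [set x | f x != 0] = psi @^-1` closure [set x | f x != 0].
  by rewrite image_preimage.
rewrite [X in _ `<=` X](closure_id _).1; last first.
  by apply: closed_comp => //; exact: closed_closure.
by apply: closure_subset => x fx; apply: (@subset_closure _ [set x | f x != 0]).
Qed.

Let measurable_lc (V : Type) (f : G -> V) (D : set G) d (T : measurableType d)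
  (g : V -> T) : locally_constant f -> measurable (D : set (borel G)) ->
  measurable_fun (D : set (borel G)) (g \o f : borel G -> T).
Proof.
move=> lf mD; apply: (@measurable_funS _ _ (borel G) T setT) => // _ B _.
rewrite setTI; apply: measurable_open.
exact: (open_locally_constant (g @^-1` B) lf).
Qed.

Lemma Rintegral_lc_pushforward nu (A : borel_set G) (V : Type) (f : G -> V)
    (g : V -> R) : locally_constant f ->
  \int[nu]_(x in phi @^-1` sval A) (g (f x)) =
  \int[push nu]_(x in sval A) g (f (psi x)).
Proof.
move=> lf; rewrite /Rintegral; congr fine.
have lfp : locally_constant (f \o psi) by move=> x; exact: cpsi (lf (psi x)).
rewrite integralE [RHS]integralE; congr (_ - _)%E.
  rewrite (@ge0_integral_pushforward _ _ (borel G) (borel G) R phi mphi nu).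
  - by apply: eq_integral => x _; rewrite /= !funeposE /= phiK.
  - exact: svalP.
  - apply: measurable_funepos.
    apply: (@measurable_lc _ (f \o psi) _ _ _ (fun v => (g v)%:E)) => //.
    exact: svalP.
  - by move=> y _; exact: funepos_ge0.
rewrite (@ge0_integral_pushforward _ _ (borel G) (borel G) R phi mphi nu).
- by apply: eq_integral => x _; rewrite /= !funenegE /= phiK.
- exact: svalP.
- apply: measurable_funeneg.
  apply: (@measurable_lc _ (f \o psi) _ _ _ (fun v => (g v)%:E)) => //.
  exact: svalP.
- by move=> y _; exact: funeneg_ge0.
Qed.

Lemma density_pushforward nu (f : G -> R[i]) (A : borel_set G) :
  test_function f -> density f nu (borel_preimage cphi A) =
  density (f \o psi) (push nu) A.
Proof.
move=> [lf _]; congr Complex.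
  exact: (Rintegral_lc_pushforward _ _ (@complex.Re R)).
exact: (Rintegral_lc_pushforward _ _ (@complex.Im R)).
Qed.

Lemma smooth_pushforward (m : borel_set G -> R[i]^o) :
  (forall nu, haar nu -> haar (push nu)) ->
  is_smooth m -> is_smooth (fun A => m (borel_preimage cphi A)).
Proof.
move=> hphi [n [a [f [nu [h ->]]]]].
exists n, a, (fun i => f i \o psi),
  (fun i => push (nu i)).
split=> [i|]; first by split; [apply: test_function_comp|apply: hphi]; case: (h i).
apply/funext => A; rewrite !fct_sumE; apply: eq_bigr => i _ /=.
by congr (_ * _); apply: density_pushforward; case: (h i).
Qed.

End pushforward.

Section haar_push.
Variables (R : realType) (G : topologicalGroupType).
Variables (phi psi : G -> G).
Hypotheses (cphi : continuous phi) (cpsi : continuous psi).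
Hypotheses (phiK : cancel phi psi) (psiK : cancel psi phi).
Implicit Type nu : {measure set (borel G) -> \bar R}.

Let push_setT nu : push cphi nu setT = nu setT.
Proof. by rewrite /push /= /pushforward preimage_setT. Qed.

Let measurable_preimage (A : set (borel G)) :
  measurable A -> measurable (phi @^-1` A : set (borel G)).
Proof. by move=> mA; exact: (borel_preimage_subproof cphi (exist _ A mA)). Qed.

Lemma haar_push_translation (tau : G -> G) (rho : G -> G) nu :
  (forall g x, (g * phi x)%g = phi (tau g * x)%g) ->
  (forall g x, (phi x * g)%g = phi (x * rho g)%g) ->
  haar nu -> haar (push cphi nu).
Proof.
move=> htau hrho [] [rnu nu0 inv]; [left|right]; split; rewrite ?push_setT//;
  try exact: (radon_pushforward cphi cpsi phiK psiK).
- move=> g A mA; rewrite /push /= /pushforward.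
  rewrite -[RHS](inv (tau g) _ (measurable_preimage mA)).
  by congr (nu _); apply/seteqP; split=> x; rewrite /= htau.
- move=> g A mA; rewrite /push /= /pushforward.
  rewrite -[RHS](inv (rho g) _ (measurable_preimage mA)).
  by congr (nu _); apply/seteqP; split=> x; rewrite /= hrho.
Qed.

Lemma haar_push_anti (tau : G -> G) nu :
  (forall g x, (g * phi x)%g = phi (x * tau g)%g) ->
  (forall g x, (phi x * g)%g = phi (tau g * x)%g) ->
  haar nu -> haar (push cphi nu).
Proof.
move=> htau hrho [] [rnu nu0 inv]; [right|left]; split; rewrite ?push_setT//;
  try exact: (radon_pushforward cphi cpsi phiK psiK).
- move=> g A mA; rewrite /push /= /pushforward.
  rewrite -[RHS](inv (tau g) _ (measurable_preimage mA)).
  by congr (nu _); apply/seteqP; split=> x; rewrite /= hrho.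
- move=> g A mA; rewrite /push /= /pushforward.
  rewrite -[RHS](inv (tau g) _ (measurable_preimage mA)).
  by congr (nu _); apply/seteqP; split=> x; rewrite /= htau.
Qed.

End haar_push.

Section translate.
Variables (R : realType) (G : topologicalGroupType) (g1 g2 : G).

Let phi (x : G) : G := (g1 * x * g2^-1)%g.
Let psi (x : G) : G := (g1^-1 * x * g2)%g.

Fact translate_continuous : continuous phi.
Proof. by apply: continuousMg; [apply: continuousMg|]; (exact: continuous_cstg || exact: continuous_idg). Qed.

Let cpsi : continuous psi.
Proof. by apply: continuousMg; [apply: continuousMg|]; (exact: continuous_cstg || exact: continuous_idg). Qed.

Let phiK : cancel phi psi.
Proof. by move=> x; rewrite /psi /phi !mulgA mulVg mul1g -mulgA mulVg mulg1. Qed.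

Let psiK : cancel psi phi.
Proof. by move=> x; rewrite /psi /phi !mulgA mulgV mul1g -mulgA mulgV mulg1. Qed.

Fact translate_subproof (m : smooth_measure R G) :
  (fun A => smooth_val m (borel_preimage translate_continuous A))
    \in @smooth_pred R G.
Proof.
apply/asboolP; apply: (@smooth_pushforward _ _ _ _ translate_continuous cpsi phiK psiK
  (smooth_val m)).
  move=> nu; apply: (haar_push_translation _ cpsi phiK psiK
    (tau := fun g => (g1^-1 * g * g1)%g) (rho := fun g => (g2^-1 * g * g2)%g)).
    by move=> g x; rewrite /phi !mulgA mulgV mul1g.
  by move=> g x; rewrite /phi !mulgA mulgK.
by apply/asboolP; case: m.
Qed.

(* The pushforward of m along x |-> g1 x g2^-1. *)
Definition translate (m : smooth_measure R G) : smooth_measure R G :=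
  SmoothMeasure (translate_subproof m).

End translate.

Record anti_involution (G : topologicalGroupType) := AntiInvolution {
  anti_fun :> G -> G;
  anti_continuous : continuous anti_fun;
  antiM : forall x y, anti_fun (x * y)%g = (anti_fun y * anti_fun x)%g;
  antiK : involutive anti_fun
}.

Arguments anti_continuous {G} _.
Arguments antiM {G} _.
Arguments antiK {G} _.

Section anti_pushforward.
Variables (R : realType) (G : topologicalGroupType).
Variable sigma : anti_involution G.

Fact anti_pushforward_subproof (m : smooth_measure R G) :
  (fun A => smooth_val m (borel_preimage (anti_continuous sigma) A))
    \in @smooth_pred R G.
Proof.
pose c := anti_continuous sigma; have K := antiK sigma.
apply/asboolP; apply: (@smooth_pushforward _ _ _ _ c c K K (smooth_val m)).
  by move=> nu; apply: (haar_push_anti _ c K K (tau := sigma)) => g x;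
    rewrite antiM K.
by apply/asboolP; case: m.
Qed.

Definition anti_pushforward (m : smooth_measure R G) : smooth_measure R G :=
  SmoothMeasure (anti_pushforward_subproof m).

Fact anti_pushforward_linear : linear anti_pushforward.
Proof. by move=> a u v; apply: val_inj. Qed.

HB.instance Definition _ := GRing.isLinear.Build R[i] (smooth_measure R G)
  (smooth_measure R G) _ anti_pushforward anti_pushforward_linear.

(* <sigma(xi), m> = <xi, sigma_* m> *)
Definition anti_gen_fun (xi : generalized_function R G) :
  generalized_function R G := xi \o anti_pushforward.

End anti_pushforward.

Definition biinvariant (R : realType) (G : topologicalGroupType)
    (H : groupClosed G) (xi : generalized_function R G) :=
  forall h1 h2, h1 \in H -> h2 \in H ->
    forall m, xi (translate h1 h2 m) = xi m.

Section induction.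
Variables (R : realType) (G : topologicalGroupType) (H : groupClosed G).

(* The support is compact modulo H when it lies in H C for a compact C. No
   closure is needed: a right U-invariant f has clopen support. *)
Definition is_ind (f : G -> R[i]^o) :=
  [/\ forall h g, h \in H -> f (h * g)%g = f g,
      exists2 U : groupClosed G, open [set` U] &
        forall u g, u \in U -> f (g * u)%g = f g &
      exists2 C : set G, compact C &
        forall g, f g != 0 -> exists h c, [/\ h \in H, C c & g = (h * c)%g]].

Definition ind_pred : {pred G -> R[i]^o} := fun f => `[< is_ind f >].

Record ind := Ind { ind_fun :> G -> R[i]^o ; _ : ind_fun \in ind_pred }.

HB.instance Definition _ := [isSub for ind_fun].
HB.instance Definition _ := [Choice of ind by <:].

Lemma indP (f : ind) : is_ind f.
Proof. by apply/asboolP; case: f. Qed.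

Fact setT_group_closed : group_closed (predT : {pred G}).
Proof. by []. Qed.

Fact setI_group_closed (U V : groupClosed G) :
  group_closed ([predI U & V] : {pred G}).
Proof.
split=> [|x y]; first by rewrite inE !gpred1.
by move=> /andP[xU xV] /andP[yU yV]; apply/andP; split; apply: gpredF.
Qed.

Fact conj_group_closed (U : groupClosed G) (g : G) :
  group_closed ([pred x | (g^-1 * x * g)%g \in U] : {pred G}).
Proof.
split=> [|x y]; first by rewrite inE mulg1 mulVg gpred1.
rewrite !inE => xU yU.
have -> : (g^-1 * (x / y) * g = (g^-1 * x * g) / (g^-1 * y * g))%g.
  by rewrite !invgM invgK !mulgA mulgK.
exact: gpredF.
Qed.

Definition group_closed_pack (S : {pred G}) (cS : group_closed S) :
    groupClosed G :=
  HB.pack S (isInvClosed.Build G S (group_closedV cS))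
    (isMul1Closed.Build G S cS.1) (isMulClosed.Build G S (group_closedM cS)).

Fact ind_submod_closed : submod_closed ind_pred.
Proof.
split=> [|a u v /asboolP[lu [U oU hU] [C cC uC]] /asboolP[lv [V oV hV] [D cD vD]]];
  apply/asboolP; split.
- by [].
- exists (group_closed_pack setT_group_closed) => //.
  by rewrite (_ : [set` _] = setT); [exact: openT|apply/seteqP].
- by exists set0; [exact: compact0|move=> g; rewrite eqxx].
- by move=> h g hH; rewrite !fctE lu// lv.
- exists (group_closed_pack (setI_group_closed U V)).
    rewrite (_ : [set` _] = [set` U] `&` [set` V]); first exact: openI.
    by apply/seteqP; split=> x /= => [/andP[]|[? ?]]; [split|apply/andP].
  by move=> x g /andP[xU xV]; rewrite !fctE hU// hV.
- exists (C `|` D); first exact: compactU.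
  move=> g; rewrite !fctE; have [u0|u0 _] := eqVneq (u g) 0; last first.
    by have [h [c [? ? ->]]] := uC g u0; exists h, c; split=> //; left.
  rewrite u0 scaler0 add0r => /vD[h [c [? ? ->]]].
  by exists h, c; split=> //; right.
Qed.

HB.instance Definition _ := GRing.isSubmodClosed.Build R[i] (G -> R[i]^o)
  ind_pred ind_submod_closed.
HB.instance Definition _ := [SubChoice_isSubLmodule of ind by <:].

Fact ind_act_subproof (g : G) (f : ind) :
  (fun x => f (x * g)%g) \in ind_pred.
Proof.
apply/asboolP; have [lf [U oU hU] [C cC fC]] := indP f; split.
- by move=> h x hH; rewrite -mulgA lf.
- exists (group_closed_pack (conj_group_closed U g)); last first.
    by move=> u x /hU uU; rewrite -[LHS](hU _ _ (gpred1 : 1%g \in U)) mulg1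
      -(uU (x * g)%g) !mulgA mulgK.
  have /continuousP : continuous (fun x : G => (g^-1 * x * g)%g).
    by apply: continuousMg; [apply: continuousMg|]; (exact: continuous_cstg || exact: continuous_idg).
  exact: (fun f => f _ oU).
- exists ((fun x => x * g^-1)%g @` C).
    apply: continuous_compact => //; apply: continuous_subspaceT.
    by apply: continuousMg; (exact: continuous_cstg || exact: continuous_idg).
  move=> x /fC[h [c [hH Cc xE]]]; exists h, (c * g^-1)%g; split=> //.
    by exists c.
  by rewrite mulgA -xE mulgK.
Qed.

Definition ind_act (g : G) (f : ind) : ind := Ind (ind_act_subproof g f).

Definition hecke_algebra : set {linear ind -> ind} :=
  [set T | forall g f, T (ind_act g f) = ind_act g (T f)].

Definition hecke_commutative :=
  forall S T, hecke_algebra S -> hecke_algebra T -> S \o T =1 T \o S.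

End induction.

(* Main.v *)
Require Import Defs.
From HB Require Import structures.
From mathcomp Require Import all_boot all_order all_algebra.
From mathcomp Require Import all_classical all_reals all_analysis.
From mathcomp Require Import complex finmap.

Set Implicit Arguments.
Unset Strict Implicit.
Unset Printing Implicit Defensive.

Import Order.TTheory GRing.Theory Num.Theory.

Local Open Scope classical_set_scope.
Local Open Scope ring_scope.

(** Attach to T in End_G(ind_H^G 1) the set function tau_T(K) = T(avg K)(1) on
    the compact open subsets K of G, where avg K in ind_H^G 1 is the image of the
    indicator function of K under integration along H. It is finitely additive,
    and invariant under left and right translation by H: on the left because avg
    is, on the right because T is equivariant and the elements of ind_H^G 1 are
    left H-invariant. A finitely additive function on compact open sets is the
    same thing as a generalized function: a smooth measure has, with respect to a
    Haar measure mu, a locally constant density with compact support, which can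
    be integrated against tau_T. Hence the hypothesis on sigma applies to tau_T
    and gives tau_T(K) = c tau_T(sigma K) for a constant c that depends neither
    on T nor on K (anti_invariant_content).

    Let theta(x) = sigma(x)^-1, and let U be a compact open subgroup stable under
    sigma. The coefficients a_T(y, x) = T(avg(yU))(x) are the values
    tau_T(y U x^-1), and sigma(y U x^-1) = theta(x) U theta(y)^-1, so
      a_T(y, x) = c a_T(theta x, theta y)       (coefficient_symmetry).
    In other words T and its conjugate by theta are adjoint to each other for the
    natural pairing on ind_H^G 1; as passing to the adjoint reverses products
    while conjugation preserves them, all such T commute. Concretely, the
    functions avg(yU) span the right U-invariant elements of ind_H^G 1
    (ind_span_avg), and expanding S(avg(zU)) and T(avg(theta(x)U)) in them turns
    T(S(avg(zU)))(x) and S(T(avg(zU)))(x) into the same double sum, by the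
    symmetry for S, T, their composite and the identity (hecke_comm_avg).

    Small U exist by van Dantzig's theorem. They replace measure theory by
    counting: two Haar measures of a compact open set are both proportional to
    the number of U-cosets in it, so they are proportional to each other on such
    sets (haar_vol_proportional), which is all the uniqueness that is needed. *)

(** * Compact open subgroups of totally disconnected groups *)

Section compact_open_sets.
Variable G : topologicalGroupType.
Implicit Types (K L V W : set G) (x y : G).

Definition copen K := compact K /\ open K.

Lemma copen0 : copen set0.
Proof. by split; [exact: compact0|exact: open0]. Qed.

Lemma copen_preimage (phi psi : G -> G) K :
  continuous phi -> continuous psi -> cancel phi psi -> cancel psi phi ->
  copen K -> copen (phi @^-1` K).
Proof.
move=> cphi cpsi phiK psiK [cK oK]; split; last by move/continuousP: cphi; exact.
rewrite (_ : _ @^-1` _ = psi @` K).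
  by apply: continuous_compact => //; exact: continuous_subspaceT.
by apply/seteqP; split=> [x Kx|_ [x Kx <-] /=]; [exists (phi x)|rewrite psiK].
Qed.

Lemma continuous_translation (a b : G) : continuous (fun x : G => (a * x * b)%g).
Proof.
by apply: continuousMg; [apply: continuousMg|];
  (exact: continuous_cstg || exact: continuous_idg).
Qed.

Lemma copen_translate (a b : G) K :
  copen K -> copen [set x | K (a * x * b)%g].
Proof.
apply: (@copen_preimage _ (fun x => a^-1 * x * b^-1)%g).
- exact: continuous_translation.
- exact: continuous_translation.
- by move=> x; rewrite !mulgA mulVg mul1g mulgK.
- by move=> x; rewrite !mulgA mulgV mul1g mulgVK.
Qed.

Lemma open_translate (a b : G) W : open W -> open [set x | W (a * x * b)%g].
Proof. by move/continuousP: (@continuous_translation a b); exact. Qed.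

Lemma copenU K L : copen K -> copen L -> copen (K `|` L).
Proof. by move=> [? ?] [? ?]; split; [exact: compactU|exact: openU]. Qed.

Definition subgroup V := V 1%g /\ forall x y, V x -> V y -> V (x^-1 * y)%g.

Definition cosubgroup V := subgroup V /\ copen V.

(** Invariance of a set under right translation by V, phrased through the
    congruence x^-1 * y \in V so that no product has to be cancelled. *)
Definition right_stable V K := forall x y, V (x^-1 * y)%g -> K x -> K y.

Definition lcoset x V : set G := [set y | V (x^-1 * y)%g].

Section subgroup_theory.
Variable V : set G.
Hypothesis sV : subgroup V.

Lemma subgroupV x : V x -> V x^-1%g.
Proof. by move=> Vx; rewrite -(mulg1 x^-1%g); apply: sV.2 => //; exact: sV.1. Qed.

Lemma subgroupM x y : V x -> V y -> V (x * y)%g.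
Proof. by move=> Vx Vy; rewrite -(invgK x); apply: sV.2 => //; exact: subgroupV. Qed.

Lemma cong_refl x : V (x^-1 * x)%g.
Proof. by rewrite mulVg; exact: sV.1. Qed.

Lemma cong_sym x y : V (x^-1 * y)%g -> V (y^-1 * x)%g.
Proof. by move=> /subgroupV; rewrite invgM invgK. Qed.

Lemma cong_trans x y z : V (x^-1 * y)%g -> V (y^-1 * z)%g -> V (x^-1 * z)%g.
Proof. by move=> xy yz; have := subgroupM xy yz; rewrite mulgA mulgK. Qed.

Lemma right_stable_lcoset x : right_stable V (lcoset x V).
Proof. by move=> y z yz xy; exact: cong_trans yz. Qed.

Lemma right_stable_eq K x y : right_stable V K -> V (x^-1 * y)%g ->
  (x \in K) = (y \in K).
Proof.
move=> VK xy; apply/idP/idP => /set_mem Kz; apply: mem_set; apply: VK Kz => //.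
exact: cong_sym.
Qed.

End subgroup_theory.

Lemma copen_lcoset x V : copen V -> copen (lcoset x V).
Proof.
move=> /(@copen_translate x^-1%g 1%g); congr copen.
by apply/seteqP; split=> y /=; rewrite mulg1.
Qed.

Lemma subgroup_translate (a : G) V : subgroup V ->
  subgroup [set x | V (a * x * a^-1)%g].
Proof.
move=> [V1 VV]; split=> [|x y Vx Vy] /=; first by rewrite mulg1 mulgV.
have := VV _ _ Vx Vy.
by rewrite [(a * x * a^-1)^-1%g]invgM invgK invgM !mulgA mulgVK.
Qed.

Lemma subgroupI V W : subgroup V -> subgroup W -> subgroup (V `&` W).
Proof.
by move=> [V1 VV] [W1 WW]; split=> [|x y [? ?] [? ?]]; split=> //;
  [exact: VV|exact: WW].
Qed.

Lemma cosubgroupI V W : hausdorff_space G ->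
  cosubgroup V -> cosubgroup W -> cosubgroup (V `&` W).
Proof.
move=> hG [sV [cV oV]] [sW [cW oW]]; split; first exact: subgroupI.
by split; [apply: compact_closedI => //; exact: compact_closed|exact: openI].
Qed.

Lemma copenD K L : hausdorff_space G ->
  copen K -> copen L -> copen (K `\` L).
Proof.
move=> hG [cK oK] [cL oL]; split.
  by apply: compact_closedI => //; exact: open_closedC.
by apply: openI => //; apply: closed_openC; exact: compact_closed.
Qed.

(** An open subgroup is closed, because its complement is a union of cosets. *)
Lemma subgroup_nbhs_clopen V : subgroup V -> nbhs 1%g V -> open V /\ closed V.
Proof.
move=> sV nV.
have coset_nbhs x : nbhs x (lcoset x V).
  move: nV; rewrite nbhsE => -[ O [oO O1] OV].
  apply: (@filterS _ _ _ [set y | O (x^-1 * y * 1)%g]).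
    by move=> y /=; rewrite mulg1 => /OV.
  by apply: open_nbhs_nbhs; split; [exact: open_translate|rewrite /= mulg1 mulVg].
split.
  rewrite openE => x Vx; apply: filterS (coset_nbhs x) => y xy.
  by have := subgroupM sV Vx xy; rewrite mulVKg.
rewrite -[V]setCK; apply: open_closedC; rewrite openE => x nVx.
apply: filterS (coset_nbhs x) => y xy Vy; apply: nVx.
by have := subgroupM sV Vy (subgroupV sV xy); rewrite invgM invgK mulVKg.
Qed.

End compact_open_sets.

(** Otherwise the sets A `&` K generate a proper filter, and a cluster point of
    it in K lies in every A, since each A is closed. *)
Lemma compact_directed_bigcap (T : topologicalType) (D : set (set T)) (K : set T) :
  compact K -> D !=set0 -> (forall A, D A -> closed A) ->
  (forall A B, D A -> D B -> D (A `&` B)) ->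
  K `&` \bigcap_(A in D) A = set0 -> exists2 A, D A & A `&` K = set0.
Proof.
move=> cK [A0 DA0] clD DI KD; apply: contrapT => /forall2NP h.
have DK A : D A -> (A `&` K) !=set0.
  by move=> DA; have [//|/eqP/set0P//] := h A.
pose F := filter_from D (fun A => A `&` K).
have FF : ProperFilter F.
  apply: filter_from_proper; last exact: DK.
  apply: filter_from_filter; first by exists A0.
  by move=> A B DA DB; exists (A `&` B); [exact: DI|rewrite setIACA setIid].
have [|x [Kx Fx]] := cK F FF; first by exists A0 => // x [].
suff : set0 x by []; rewrite -KD; split=> // A DA.
rewrite (closure_id A).1; last exact: clD.
by move=> B nB; apply: Fx nB; exists A => // y [].
Qed.

Section van_dantzig.
Variable G : topologicalGroupType.
Hypotheses (lcG : locally_compact [set: G]) (tdG : totally_disconnected [set: G])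
  (hG : hausdorff_space G).

Let compact_nbhs1 : exists2 C : set G, compact C & nbhs 1%g C.
Proof.
have [//|U nU [cU _]] := lcG (x := 1%g).
exists U => //; move: nU; rewrite /within/= /globally/=.
by apply: filterS => x /(_ I).
Qed.

(** The set A N, for N a small enough neighbourhood of 1, is an open
    neighbourhood of A disjoint from B N. *)
Lemma compact_closed_separated (A B : set G) : compact A -> closed B ->
  A `&` B = set0 -> exists U W : set G,
    [/\ open U, open W, A `<=` U, B `<=` W & U `&` W = set0].
Proof.
move=> /compact_near_coveringP cA clB AB.
have [|[N M]/= [nN nM] NM] := cA _ (nbhs (1%g : G, 1%g : G))
  (fun i x => ~ B (x * i.1 * i.2^-1)%g).
  move=> x Ax.
  have c : continuous (fun u : G * (G * G) => (u.1 * u.2.1 * u.2.2^-1)%g).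
    apply: continuousMg; [apply: continuousMg|apply: continuousVg] => u.
    - exact: cvg_fst.
    - by apply: continuous_comp; [exact: cvg_snd|exact: cvg_fst].
    - by apply: continuous_comp; [exact: cvg_snd|exact: cvg_snd].
  apply: (c (x, (1%g, 1%g)) (~` B)); apply: open_nbhs_nbhs; split.
    exact: closed_openC.
  rewrite /= mulg1 divg1 => Bx; suff : set0 x by [].
  by rewrite -AB.
pose U (C N : set G) := \bigcup_(x in C) [set y | N° (x^-1 * y * 1)%g].
have oU C P : open (U C P).
  by apply: bigcup_open => x _; apply: open_translate; exact: open_interior.
have CU C P : nbhs 1%g P -> C `<=` U C P.
  by move=> nP x Cx; exists x => //=; rewrite mulg1 mulVg; exact: nP.
exists (U A N), (U B M); split=> //; [exact: CU|exact: CU|].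
apply/seteqP; split=> // z [[a Aa /=] + [b Bb /=]]; rewrite !mulg1.
move=> /interior_subset Na /interior_subset Mb.
apply: (NM (_, _) _ _ Aa) => /=; first by split; [exact: Na|exact: Mb].
by rewrite mulVKg invgM invgK mulVKg.
Qed.

Definition relatively_clopen1 (C : set G) : set (set G) :=
  [set D | [/\ closed D, exists2 O, open O & D = C `&` O & D 1%g]].

Lemma relatively_clopen1I C D E : relatively_clopen1 C D ->
  relatively_clopen1 C E -> relatively_clopen1 C (D `&` E).
Proof.
move=> [clD [ O oO DE] D1] [clE [P oP EE] E1]; split=> //.
- exact: closedI.
- by exists (O `&` P); [exact: openI|rewrite DE EE setIACA setIid].
Qed.

Lemma relatively_clopen1_id C : compact C -> C 1%g -> relatively_clopen1 C C.
Proof.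
move=> cC C1; split=> //; first exact: compact_closed.
by exists setT; [exact: openT|rewrite setIT].
Qed.

(** The intersection Q is connected: the two parts of a separation of Q lie in
    disjoint open sets, whose union contains some relatively clopen D by
    compactness, so that one of the two parts is already cut out of D. *)
Lemma quasi_component1 (C : set G) : compact C -> C 1%g ->
  \bigcap_(D in relatively_clopen1 C) D = [set 1%g].
Proof.
move=> cC C1; set Q := \bigcap_(D in _) D.
have clopC := relatively_clopen1_id cC C1.
have clQ : closed Q by apply: closed_bigI => D [].
have QC : Q `<=` C by move=> x; exact.
have Q1 : Q 1%g by move=> D [].
have part A B : closed A -> closed B -> A `&` B = set0 -> Q = A `|` B ->
    A 1%g -> B = set0.
  move=> clA clB AB QE A1.
  have cA : compact A.
    by apply: (subclosed_compact clA cC) => x Ax; apply: QC; rewrite QE; left.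
  have [U [W [oU oW AU BW UW]]] := compact_closed_separated cA clB AB.
  have [|||||D cD DUW] := @compact_directed_bigcap _ (relatively_clopen1 C)
    (C `&` ~` (U `|` W)).
  - by apply: compact_closedI => //; apply: open_closedC; exact: openU.
  - by exists C.
  - by move=> D [].
  - exact: relatively_clopen1I.
  - apply/seteqP; split=> // x [[Cx nUW]]; rewrite -/Q QE => -[/AU|/BW] h.
      by apply: nUW; left.
    by apply: nUW; right.
  have [clD [ O oO DE] D1] := cD.
  have QU : Q `<=` D `&` U.
    move=> t; apply; split.
    - rewrite (_ : _ `&` _ = D `&` ~` W).
        by apply: closedI => //; exact: open_closedC.
      apply/seteqP; split=> x [Dx] => [Ux|nWx]; split=> //.
        by move=> Wx; suff : set0 x by []; rewrite -UW.
      apply: contrapT => nUx; suff : set0 x by [].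
      by rewrite -DUW; split=> //; split=> [|[]//]; move: Dx; rewrite DE => -[].
    - by exists (O `&` U); [exact: openI|rewrite DE setIA].
    - by split=> //; exact: AU.
  apply/seteqP; split=> // x Bx; suff : set0 x by []; rewrite -UW; split.
    by have [] := QU x; rewrite // QE; right.
  exact: BW.
have cQ : connected Q.
  move=> B [b Bb] [ O oO BO] [D clD BD].
  have QB : Q = B `|` (Q `&` ~` O).
    by rewrite BO -setIUr setUv setIT.
  have QB0 : B `&` (Q `&` ~` O) = set0.
    by rewrite BO setIACA setICr setI0.
  have clB : closed B by rewrite BD; exact: closedI.
  have clB' : closed (Q `&` ~` O) by apply: closedI => //; exact: open_closedC.
  have [B1|nB1] := pselect (B 1%g).
    by rewrite [RHS]QB (part _ _ clB clB')// setU0.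
  have : (Q `&` ~` O) 1%g by split=> // O1; apply: nB1; rewrite BO.
  move=> /(part _ _ clB' clB); rewrite setIC setUC => /(_ QB0 QB) B0.
  by move: Bb; rewrite B0.
have := tdG (x := 1%g) I; rewrite eqEsubset => -[Q1' _]; apply/seteqP; split.
  by move=> x Qx; apply: Q1'; exists Q.
by move=> _ ->.
Qed.

Lemma copen_nbhs1 (W : set G) : nbhs 1%g W ->
  exists K, [/\ copen K, K 1%g & K `<=` W].
Proof.
move=> nW; have [C cC nC] := compact_nbhs1; have C1 := nbhs_singleton nC.
pose O := (C `&` W)°.
have O1 : O 1%g by exact: filterI.
have [|||||D [clD [P oP DE] D1] DO] := @compact_directed_bigcap _
  (relatively_clopen1 C) (C `&` ~` O).
- by apply: compact_closedI => //; apply: open_closedC; exact: open_interior.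
- by exists C; exact: relatively_clopen1_id.
- by move=> D [].
- exact: relatively_clopen1I.
- by rewrite quasi_component1//; apply/seteqP; split=> // x [[_ nOx] xE];
    apply: nOx; rewrite xE.
have DsubO : D `<=` O.
  move=> x Dx; apply: contrapT => nOx; suff : set0 x by [].
  by rewrite -DO; split=> //; split=> //; move: Dx; rewrite DE => -[].
exists D; split=> //; last by move=> x /DsubO /interior_subset [].
split; first by apply: (subclosed_compact clD cC); rewrite DE => x [].
rewrite (_ : D = O `&` P); first by apply: openI => //; exact: open_interior.
apply/seteqP; split=> x.
  by move=> Dx; split; [exact: DsubO|move: Dx; rewrite DE => -[]].
by move=> [/interior_subset[Cx _] Px]; rewrite DE.
Qed.

(** The right translations that preserve a compact open neighbourhood K of 1
    form an open subgroup contained in K. *)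
Theorem van_dantzig (W : set G) : nbhs 1%g W ->
  exists2 V, cosubgroup V & V `<=` W.
Proof.
move=> /copen_nbhs1[K [[cK oK] K1 KW]].
pose V := [set g : G | forall x, K (x * g)%g <-> K x].
have sV : subgroup V.
  split=> [x|g h gV hV x] /=; first by rewrite mulg1.
  by rewrite mulgA hV -{2}(mulgVK g x); exact: iff_sym.
have nK : nbhs 1%g [set g | forall x, K x -> K (x * g)%g].
  move/compact_near_coveringP : cK => /(_ _ (nbhs (1%g : G)) (fun g x => K (x * g)%g)).
  apply=> x Kx; apply: (@mulg_continuous G (x, 1%g) K).
  by apply: open_nbhs_nbhs; rewrite /= mulg1.
have nV : nbhs 1%g V.
  have nKV : nbhs 1%g [set g : G | forall x, K x -> K (x * g^-1)%g].
    apply: (@invg_continuous G 1%g [set g : G | forall x, K x -> K (x * g)%g]).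
    by rewrite invg1.
  apply: filterS2 nK nKV => g gK gVK x; split; last exact: gK.
  by move=> /gVK; rewrite mulgK.
have [oV clV] := subgroup_nbhs_clopen sV nV.
have VK : V `<=` K by move=> g /(_ 1%g); rewrite mul1g => ->.
exists V; last exact: subset_trans KW.
by split=> //; split=> //; exact: subclosed_compact VK.
Qed.

End van_dantzig.

(** * Counting cosets of compact open subgroups *)

(** From here on this property stands for local compactness together with total
    disconnectedness. *)
Definition small_cosubgroups (G : topologicalGroupType) :=
  forall W : set G, nbhs 1%g W -> exists2 V, cosubgroup V & V `<=` W.

Lemma compact_translates (G : topologicalGroupType) (C W : set G) :
  compact C -> open W -> W 1%g ->
  exists s : seq G, forall x, C x -> exists2 y, y \in s & W (y^-1 * x)%g.
Proof.
(* compact_cover speaks of pointed spaces, so G is pointed at the identity. *)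
pose pG : ptopologicalType := HB.pack_for ptopologicalType (G : Type)
  (isPointed.Build G 1%g) (TopologicalGroup.on G).
move=> cC oW W1; have : @compact pG C by [].
rewrite compact_cover => /(_ G setT (fun x => lcoset x W)) [||D _ CD].
- move=> x _; have := open_translate x^-1%g 1%g oW; congr open.
  by apply/seteqP; split=> y; rewrite /lcoset/= mulg1.
- by move=> x Cx; exists x => //; rewrite /lcoset/= mulVg.
by exists (enum_fset D) => x /CD[y Dy yx]; exists y.
Qed.

Section cosets.
Variable G : topologicalGroupType.
Hypotheses (hG : hausdorff_space G) (sG : small_cosubgroups G).
Implicit Types (K L V W : set G) (x y : G).

(** Near each point of C the values f (x * g) and f x agree for small g, and
    compactness makes the bound on g uniform; a point outside C is reached
    backwards from its translate, as g ranges over a group. *)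
Lemma locally_constant_cosubgroup (T : Type) (f : G -> T) (t : T) (C : set G) :
  locally_constant f -> compact C -> (forall x, f x <> t -> C x) ->
  exists2 V, cosubgroup V & forall x y, V (x^-1 * y)%g -> f x = f y.
Proof.
move=> lf /compact_near_coveringP cC fC.
have [|V cV VC] := sG (W := [set g | forall x, C x -> f (x * g)%g = f x]).
  apply: (cC _ (nbhs (1%g : G)) (fun g x => f (x * g)%g = f x)) => x Cx.
  have fxg : nbhs (x, 1%g : G) [set u | f (u.1 * u.2)%g = f x].
    by apply: (@mulg_continuous G (x, 1%g) [set y | f y = f x]);
      rewrite -[x in f x]mulg1; exact: lf.
  have fx1 : nbhs (x, 1%g : G) [set u | f u.1 = f x].
    exact: (@cvg_fst _ _ (nbhs x) (nbhs (1%g : G)) _ [set y | f y = f x] (lf x)).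
  by apply: filterS2 fxg fx1 => - [y g] /= -> ->.
exists V => // x y xy.
have [sV _] := cV.
have fV z g : V g -> f z <> t -> f (z * g)%g = f z by move=> Vg /fC; exact: VC.
have [fx|/(fV x _ xy)] := pselect (f x = t); last by rewrite mulVKg.
have [->//|/(fV y _ (cong_sym sV xy))] := pselect (f y = t).
by rewrite mulVKg.
Qed.

Lemma copen_right_stable K : copen K ->
  exists2 V, cosubgroup V & right_stable V K.
Proof.
move=> [cK oK].
have [||x|V cV KV] := @locally_constant_cosubgroup _ (fun x => x \in K) false K.
- move=> x; have [Kx|nKx] := pselect (K x).
    rewrite (mem_set Kx); apply: filterS (open_nbhs_nbhs (conj oK Kx)) => y Ky.
    exact: mem_set.
  have oKC : open (~` K) by apply: closed_openC; exact: compact_closed.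
  rewrite (memNset nKx); apply: filterS (open_nbhs_nbhs (conj oKC nKx)) => y nKy.
  exact: memNset.
- by [].
- by move=> /eqP; rewrite eqbF_neg negbK => /set_mem.
- by exists V => // x y /KV xy /mem_set; rewrite xy => /set_mem.
Qed.

Lemma right_stableS V W K : W `<=` V -> right_stable V K -> right_stable W K.
Proof. by move=> WV VK x y /WV; exact: VK. Qed.

Definition incongruent V (s : seq G) :=
  pairwise (fun x y => ~~ `[< V (x^-1 * y)%g >]) s.

Lemma compact_transversal V (C : set G) : subgroup V -> open V -> compact C ->
  exists2 s, incongruent V s & forall x, C x -> exists2 y, y \in s & V (y^-1 * x)%g.
Proof.
move=> sV oV cC.
have [l] := compact_translates cC oV sV.1.
elim: l C {cC} => [|a l IH] C Cl.
  by exists nil => // x /Cl[].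
have [s is_ sC] := IH (C `&` [set x | exists2 y, y \in l & V (y^-1 * x)%g])
  (fun x => fun h => h.2).
have [as_|as_] := pselect (exists2 y, y \in s & V (y^-1 * a)%g).
  exists s => // x Cx; have [y] := Cl x Cx; rewrite inE => /predU1P[->|yl] yx.
    have [z zs za] := as_; exists z => //; exact: cong_trans za yx.
  by apply: sC; split=> //; exists y.
exists (a :: s).
  apply/andP; split; last exact: is_.
  apply/allP => y ys; apply/asboolPn => ay.
  by apply: as_; exists y => //; exact: cong_sym.
move=> x Cx; have [xl|nxl] := pselect (exists2 y, y \in l & V (y^-1 * x)%g).
  by have [//|y ys yx] := sC x; exists y => //; rewrite inE ys orbT.
have [y] := Cl x Cx; rewrite inE => /predU1P[->|yl] yx.
  by exists a => //; rewrite inE eqxx.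
by case: nxl; exists y.
Qed.

Definition content_on (Z : zmodType) (tau : set G -> Z) :=
  forall K L, copen K -> copen L -> K `&` L = set0 ->
    tau (K `|` L) = tau K + tau L.

(** L is the disjoint union of the cosets of its representatives, which are
    removed one at a time. *)
Lemma content_coset_sum (Z : zmodType) (tau : set G -> Z) V (s : seq G) L :
  content_on tau -> cosubgroup V -> incongruent V s -> copen L ->
  right_stable V L -> (forall x, L x -> exists2 y, y \in s & V (y^-1 * x)%g) ->
  tau L = \sum_(x <- s | x \in L) tau (lcoset x V).
Proof.
move=> ctau [sV cV]; elim: s L => [|a s IH] L /=.
  move=> _ _ _ Ls; rewrite big_nil (_ : L = set0); last first.
    by apply/seteqP; split=> // x /Ls[].
  have := ctau _ _ (copen0 G) (copen0 G) (setI0 _).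
  by rewrite setU0 => /eqP; rewrite -subr_eq subrr => /eqP.
rewrite /incongruent/= => /andP[/allP as_ is_] cL VL Ls; rewrite big_cons.
have [aL|aL] := boolP (a \in L); last first.
  apply: IH => // x Lx; have [y] := Ls x Lx.
  rewrite inE => /predU1P[->|ys] yx; last by exists y.
  by move: aL; rewrite (right_stable_eq sV VL yx) (mem_set Lx).
have cosetL : lcoset a V `<=` L by move=> y ay; exact: (VL a _ ay (set_mem aL)).
have ca : copen (lcoset a V) by exact: copen_lcoset.
rewrite -[in LHS](setDUK cosetL) ctau//; [|exact: copenD|exact: setDIK].
congr (_ + _); rewrite (IH (L `\` lcoset a V))//.
- rewrite big_seq_cond [RHS]big_seq_cond; apply: eq_bigl => x.
  have [xs/=|//] := boolP (x \in s).
  have nax : ~ lcoset a V x by move/asboolP: (as_ _ xs).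
  by apply/idP/idP => /set_mem Lx; apply/mem_set; [case: Lx|split].
- exact: copenD.
- move=> x y xy [Lx nax]; split; first exact: VL Lx.
  by move=> ay; apply: nax; exact: (cong_trans sV ay (cong_sym sV xy)).
- move=> x [Lx nax]; have [y] := Ls x Lx.
  by rewrite inE => /predU1P[->|ys] yx; [|exists y].
Qed.

End cosets.

(** * Haar measures on compact open sets *)

Section haar_measures.
Variables (R : realType) (G : topologicalGroupType).
Hypothesis hG : hausdorff_space G.
Implicit Types (nu mu : {measure set (borel G) -> \bar R}) (K V : set G).

Lemma copen_measurable K : copen K -> measurable (K : set (borel G)).
Proof. by move=> [_ oK]; exact: measurable_open. Qed.

Lemma compact_measurable K : compact K -> measurable (K : set (borel G)).
Proof.
move=> /(compact_closed hG) clK; rewrite -[K]setCK.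
by apply: measurableC; apply: measurable_open; exact: closed_openC.
Qed.

Lemma left_invariant_lcoset nu x V : left_invariant nu ->
  measurable (V : set (borel G)) -> nu (lcoset x V) = nu V.
Proof. by move=> inv mV; exact: inv. Qed.

(** If W were null, so would be every compact set, being covered by finitely many
    translates of W, and then the whole group by inner regularity. *)
Lemma left_haar_neq0 nu (W : set G) : left_haar nu -> open W -> W 1%g ->
  nu W != 0%E.
Proof.
move=> [[_ _ inu] nuT inv] oW W1; apply: contra nuT => /eqP nuW.
rewrite inu; last exact: openT.
rewrite eq_le; apply/andP; split; last first.
  apply: ereal_sup_ubound; exists set0; last exact: measure0.
  by split; [exact: compact0|].
apply: ge_ereal_sup => _ [K [cK _] <-].
have [s sK] := compact_translates cK oW W1.
have ocoset x : open (lcoset x W).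
  have := open_translate x^-1%g 1%g oW; congr open.
  by apply/seteqP; split=> y; rewrite /lcoset/= mulg1.
have [A [mA nuA KA]] : exists A : set (borel G),
    [/\ measurable A, nu A = 0%E & K `<=` A].
  elim: s K {cK} sK => [|a s IH] K Ks.
    by exists set0; split=> // x /Ks[].
  have [x [Kx nax]|A [mA nuA KA]] := IH (K `\` lcoset a W).
    by have [y] := Ks x Kx; rewrite inE => /predU1P[->|ys yx]; [|exists y].
  exists (lcoset a W `|` A); split.
  - by apply: measurableU => //; exact: measurable_open.
  - rewrite measureU0//; last exact: measurable_open.
    by rewrite left_invariant_lcoset//; exact: measurable_open.
  - by move=> x Kx; have [|nax] := pselect (lcoset a W x); [left|right; exact: KA].
rewrite -nuA; apply: le_measure => //; apply: mem_set => //.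
exact: compact_measurable.
Qed.

Definition vol nu K : R[i] := (fine (nu K))%:C%C.

Lemma vol_neq0 nu V : left_haar nu -> cosubgroup V -> vol nu V != 0.
Proof.
move=> hnu [[V1 _] [cV oV]]; rewrite /vol fmorph_eq0 fine_eq0.
  exact: left_haar_neq0.
by have [[fnu _ _] _ _] := hnu; rewrite ge0_fin_numE//; exact: fnu.
Qed.

Lemma vol_content nu : (forall K, compact K -> (nu K < +oo)%E) ->
  content_on (vol nu).
Proof.
move=> fnu K L cK cL KL; rewrite /vol measureU//; [|exact: copen_measurable..].
by rewrite fineD ?rmorphD// ge0_fin_numE//; apply: fnu; [case: cK|case: cL].
Qed.

Hypothesis sG : small_cosubgroups G.

Lemma vol_coset_count nu V (s : seq G) K :
  (forall K, compact K -> (nu K < +oo)%E) -> left_invariant nu ->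
  cosubgroup V -> incongruent V s -> copen K -> right_stable V K ->
  (forall x, K x -> exists2 y, y \in s & V (y^-1 * x)%g) ->
  vol nu K = vol nu V *+ count (fun x => x \in K) s.
Proof.
move=> fnu inu cV is_ cK VK Ks.
rewrite (content_coset_sum hG (vol_content fnu) cV is_ cK VK Ks).
rewrite (eq_bigr (fun=> vol nu V)) => [|x _].
  by rewrite big_const_seq iter_addr_0.
by rewrite /vol left_invariant_lcoset//; exact: copen_measurable cV.2.
Qed.

(** For V small, K and a fixed compact open subgroup U are unions of V-cosets, and
    the measure of either is the number of these times that of V. *)
Lemma left_invariant_vol_proportional nu mu :
  (forall K, compact K -> (nu K < +oo)%E) -> left_invariant nu -> left_haar mu ->
  exists c, forall K, copen K -> vol nu K = c * vol mu K.
Proof.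
move=> fnu inu hmu; have [[fmu _ _] _ imu] := hmu.
have [//|U cU _] := sG (W := setT); first exact: filterT.
exists (vol nu U / vol mu U) => K cK.
have [V1 cV1 V1K] := copen_right_stable hG sG cK.
have [V2 cV2 V2U] := copen_right_stable hG sG cU.2.
pose V := V1 `&` V2; have cV : cosubgroup V by exact: cosubgroupI.
have [sV [_ oV]] := cV.
have [s is_ Cs] := compact_transversal sV oV (compactU cK.1 cU.2.1).
have KE (la : {measure set (borel G) -> \bar R}) fla ila :=
  @vol_coset_count la V s K fla ila cV is_ cK
    (right_stableS (@subIsetl _ _ _) V1K) (fun x Kx => Cs x (or_introl Kx)).
have UE (la : {measure set (borel G) -> \bar R}) fla ila :=
  @vol_coset_count la V s U fla ila cV is_ cU.2
    (right_stableS (@subIsetr _ _ _) V2U) (fun x Ux => Cs x (or_intror Ux)).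
have muU := vol_neq0 hmu cU.
apply: (mulIf muU); rewrite mulrAC mulfVK//.
rewrite (KE nu)// (KE mu)// (UE nu)// (UE mu)//.
by rewrite !(mulrnAl, mulrnAr) -!mulrnA mulnC.
Qed.

Lemma copen_invg K : copen K -> copen [set x | K x^-1%g].
Proof.
by apply: (@copen_preimage _ _ (fun x => x^-1%g));
  [exact: invg_continuous|exact: invg_continuous|exact: invgK|exact: invgK].
Qed.

(** Inversion makes a right Haar measure left invariant. The image of mu under
    inversion is compared with mu in the same way. *)
Lemma haar_vol_proportional nu mu : haar nu -> left_haar mu -> right_invariant mu ->
  exists c, forall K, copen K -> vol nu K = c * vol mu K.
Proof.
move=> [[[fnu _ _] _ inu]|[radnu _ rnu]] hmu rmu.
  exact: left_invariant_vol_proportional.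
have [radmu _ _] := hmu.
have cI := @invg_continuous G.
have mI (A : set (borel G)) : measurable A ->
    measurable ([set x : G | A x^-1%g] : set (borel G)).
  by move=> mA; exact: (borel_preimage_subproof cI (exist _ A mA)).
have fpush (la : {measure set (borel G) -> \bar R}) : radon la ->
    forall K, compact K -> (push cI la K < +oo)%E.
  by move=> /(radon_pushforward cI cI (@invgK G) (@invgK G))[].
have lpush (la : {measure set (borel G) -> \bar R}) : right_invariant la ->
    left_invariant (push cI la).
  move=> ila g A mA; rewrite /push/= /pushforward/=.
  rewrite -[RHS](ila g^-1%g _ (mI _ mA)); congr (la _).
  by apply/seteqP; split=> x /=; rewrite invgM invgK.
have [c cE] := left_invariant_vol_proportional (fpush _ radnu) (lpush _ rnu) hmu.
have [d dE] := left_invariant_vol_proportional (fpush _ radmu) (lpush _ rmu) hmu.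
have volI (la : {measure set (borel G) -> \bar R}) K :
    vol (push cI la) [set x | K x^-1%g] = vol la K.
  by rewrite /vol /push/= /pushforward; congr (fine (la _))%:C%C;
    apply/seteqP; split=> x /=; rewrite invgK.
exists (c * d) => K cK; rewrite -(volI nu) cE; last exact: copen_invg.
by rewrite -mulrA -dE.
Qed.

End haar_measures.

(** * Generalized functions from finitely additive set functions *)

Section content_to_generalized_function.
Variables (R : realType) (G : topologicalGroupType).
Hypotheses (hG : hausdorff_space G) (sG : small_cosubgroups G).
Variable mu : {measure set (borel G) -> \bar R}.
Hypotheses (hmu : left_haar mu) (rmu : right_invariant mu).
Implicit Types (l : seq (R[i] * set G)) (m : borel_set G -> R[i]^o).

Definition step l (x : G) : R[i] := \sum_(p <- l) p.1 * (x \in p.2)%:R.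

Definition step_integral (tau : set G -> R[i]) l : R[i] :=
  \sum_(p <- l) p.1 * tau p.2.

(** The measure m has density step l with respect to mu, as far as its values
    on small cosets can tell. *)
Definition represents m l := (forall p, p \in l -> copen p.2) /\
  exists2 V0, cosubgroup V0 & forall V, cosubgroup V -> V `<=` V0 ->
    forall x (A : borel_set G), sval A = lcoset x V ->
    m A = step l x * vol mu V.

Lemma common_right_stable l : (forall p, p \in l -> copen p.2) ->
  exists2 V, cosubgroup V & forall p, p \in l -> right_stable V p.2.
Proof.
elim: l => [|p l IH] cl.
  by have [//|V cV _] := sG (W := setT); [exact: filterT|exists V].
have [|V cV Vl] := IH; first by move=> q ql; apply: cl; rewrite inE ql orbT.
have [W cW Wp] := copen_right_stable hG sG (cl p (mem_head _ _)).
exists (V `&` W); first exact: cosubgroupI.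
move=> q; rewrite inE => /predU1P[->|/Vl].
  by apply: right_stableS Wp; exact: subIsetr.
by apply: right_stableS; exact: subIsetl.
Qed.

Lemma common_compact l : (forall p, p \in l -> copen p.2) ->
  exists2 C : set G, compact C & forall p, p \in l -> p.2 `<=` C.
Proof.
elim: l => [|p l IH] cl; first by exists set0; first exact: compact0.
have [|C cC Cl] := IH; first by move=> q ql; apply: cl; rewrite inE ql orbT.
exists (p.2 `|` C); first by apply: compactU => //; exact: (cl p (mem_head _ _)).1.
move=> q; rewrite inE => /predU1P[->|/Cl qC]; first exact: subsetUl.
by apply: subset_trans qC _; exact: subsetUr.
Qed.

Lemma step_integral_coset_sum (tau : set G -> R[i]) l V s : content_on tau ->
  (forall p, p \in l -> copen p.2) -> cosubgroup V -> incongruent V s ->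
  (forall p, p \in l -> right_stable V p.2) ->
  (forall p x, p \in l -> p.2 x -> exists2 y, y \in s & V (y^-1 * x)%g) ->
  step_integral tau l = \sum_(x <- s) step l x * tau (lcoset x V).
Proof.
move=> ctau cl cV is_ Vl ls.
under [RHS]eq_bigr do rewrite mulr_suml.
rewrite exchange_big/= /step_integral big_seq [RHS]big_seq.
apply: eq_bigr => p pl.
rewrite (content_coset_sum hG ctau cV is_ (cl _ pl) (Vl _ pl) (fun x => ls p x pl)).
rewrite mulr_sumr big_mkcond/=; apply: eq_bigr => x _.
by case: (x \in p.2); rewrite ?mulr1 ?mulr0 ?mul0r.
Qed.

(** Both integrals equal the sum of m(xV) / mu(V) * tau(xV) over the cosets xV of a
    sufficiently small V, which only involves m. *)
Lemma represents_unique (tau : set G -> R[i]) m l l' : content_on tau ->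
  represents m l -> represents m l' -> step_integral tau l = step_integral tau l'.
Proof.
move=> ctau [cl [V0 cV0 ml]] [cl' [V0' cV0' ml']].
have cll' p : p \in l ++ l' -> copen p.2.
  by rewrite mem_cat => /orP[/cl|/cl'].
have [V1 cV1 V1l] := common_right_stable cll'.
have [C cC Cl] := common_compact cll'.
pose V := V1 `&` (V0 `&` V0').
have cV : cosubgroup V by do 2?apply: cosubgroupI.
have [sV [_ oV]] := cV.
have [s is_ Cs] := compact_transversal sV oV cC.
have VV1 : V `<=` V1 by exact: subIsetl.
have sumE l0 : {subset l0 <= l ++ l'} ->
    step_integral tau l0 = \sum_(x <- s) step l0 x * tau (lcoset x V).
  move=> l0l; apply: step_integral_coset_sum => //.
  - by move=> p /l0l; exact: cll'.
  - by move=> p /l0l/V1l; exact: right_stableS VV1.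
  - by move=> p x /l0l/Cl pC /pC/Cs.
rewrite !sumE; [|by move=> p pl; rewrite mem_cat pl ?orbT..].
apply: eq_bigr => x _; congr (_ * _).
apply: (mulIf (vol_neq0 hG hmu cV)).
pose A : borel_set G := exist _ _ (copen_measurable (copen_lcoset x cV.2)).
by rewrite -(ml V _ _ x A)// -?(ml' V _ _ x A)// => y [_ []].
Qed.

Lemma represents0 : represents 0 [::].
Proof.
split=> //; have [//|V cV _] := sG (W := setT); first exact: filterT.
by exists V => // W _ _ x A _; rewrite /step big_nil mul0r.
Qed.

Lemma step_scale_cat a l l' x :
  step ([seq (a * p.1, p.2) | p <- l] ++ l') x = a * step l x + step l' x.
Proof.
rewrite /step big_cat big_map/= mulr_sumr; congr (_ + _).
by apply: eq_bigr => p _; rewrite mulrA.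
Qed.

Lemma represents_linear a m m' l l' : represents m l -> represents m' l' ->
  represents (a *: m + m') ([seq (a * p.1, p.2) | p <- l] ++ l').
Proof.
move=> [cl [V0 cV0 ml]] [cl' [V0' cV0' ml']]; split=> [p|].
  by rewrite mem_cat => /orP[/mapP[q /cl ? ->]|/cl'].
exists (V0 `&` V0'); first exact: cosubgroupI.
move=> V cV; rewrite subsetI => -[VV0 VV0'] x A Ax.
by rewrite step_scale_cat mulrDl -mulrA -(ml V _ _ x A)// -(ml' V _ _ x A).
Qed.

Lemma step_integral_linear tau a l l' :
  step_integral tau ([seq (a * p.1, p.2) | p <- l] ++ l') =
  a * step_integral tau l + step_integral tau l'.
Proof.
rewrite /step_integral big_cat big_map/= mulr_sumr; congr (_ + _).
by apply: eq_bigr => p _; rewrite mulrA.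
Qed.

Lemma density_lcoset (f : G -> R[i]) (nu : {measure set (borel G) -> \bar R}) V x
    (A : borel_set G) : sval A = lcoset x V ->
  (forall y, V (x^-1 * y)%g -> f y = f x) ->
  density f nu A = f x * vol nu (lcoset x V).
Proof.
move=> AE fE; have partE (g : R[i] -> R) :
    \int[nu]_(y in sval A) g (f y) = g (f x) * fine (nu (sval A)).
  rewrite -(Rintegral_cst nu (svalP A)); apply: eq_Rintegral => y.
  by rewrite AE => /set_mem/fE ->.
by rewrite /density !partE -AE /vol; case: (f x) => a b; simpc.
Qed.

(** The density is constant on the cosets of some V0, hence a finite combination
    of indicator functions of such cosets. *)
Lemma represents_density (f : G -> R[i]) nu : test_function f -> haar nu ->
  exists l, represents (density f nu) l.
Proof.
move=> [lf cf] hnu.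
have [c volE] := haar_vol_proportional hG sG hnu hmu rmu.
have [x|V0 cV0 fV0] := locally_constant_cosubgroup (t := 0) sG lf cf.
  by move=> fx; apply: subset_closure; exact/eqP.
have [sV0 [_ oV0]] := cV0.
have [s is_ fs] := compact_transversal sV0 oV0 cf.
exists [seq (f x * c, lcoset x V0) | x <- s]; split.
  by move=> p /mapP[x _ ->]; exact: copen_lcoset cV0.2.
exists V0 => // V cV VV0 x A AE.
rewrite (density_lcoset _ AE) => [|y /VV0/fV0->//].
rewrite volE; last exact: copen_lcoset cV.2.
have -> : vol mu (lcoset x V) = vol mu V.
  by rewrite /vol left_invariant_lcoset//; [case: hmu|exact: copen_measurable cV.2].
rewrite mulrA; congr (_ * _); rewrite /step big_map/=.
rewrite (eq_bigr (fun y => f x * c * (x \in lcoset y V0)%:R)); last first.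
  move=> y _; have [/set_mem/fV0->//|_] := boolP (x \in _).
  by rewrite !mulr0.
rewrite -mulr_sumr; have [->|fx] := eqVneq (f x) 0; first by rewrite !mul0r.
rewrite -[LHS]mulr1; congr (_ * _).
(* The representatives of the coset of x are counted by the point mass at x. *)
pose at_x (K : set G) : R[i] := (x \in K)%:R.
have cat_x : content_on at_x.
  move=> K L _ _ KL; rewrite /at_x in_setU.
  have [xK|] := boolP (x \in K); last by rewrite add0r.
  rewrite memNset ?addr0// => xL; suff : set0 x by [].
  by rewrite -KL; split=> //; exact: set_mem.
have xx : x \in lcoset x V0 by apply: mem_set; exact: cong_refl.
have cover y : lcoset x V0 y -> exists2 z, z \in s & V0 (z^-1 * y)%g.
  move=> xy; have [|z zs zx] := fs x; first by apply: subset_closure.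
  by exists z => //; exact: cong_trans xy.
transitivity (at_x (lcoset x V0)); first by rewrite /at_x xx.
rewrite (content_coset_sum hG cat_x cV0 is_ (copen_lcoset x cV0.2)
  (right_stable_lcoset sV0 (x := x)) cover).
rewrite big_mkcond; apply: eq_bigr => y _; rewrite /at_x.
rewrite (_ : (y \in lcoset x V0) = (x \in lcoset y V0)).
  by case: (x \in lcoset y V0).
by apply/idP/idP => /set_mem xy; apply: mem_set; exact: cong_sym.
Qed.

Lemma represents_exists m : is_smooth m -> exists l, represents m l.
Proof.
move=> [n [a [f [nu [h ->]]]]].
elim/big_ind: _ => [||i _]; first by exists [::]; exact: represents0.
  move=> m1 m2 [l1 h1] [l2 h2].
  by rewrite -[m1]scale1r; eexists; exact: represents_linear h1 h2.
have [fi nui] := h i; have [l hl] := represents_density fi nui.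
by rewrite -[_ *: _]addr0; eexists; exact: represents_linear hl represents0.
Qed.

(** Integration against tau of the locally constant densities with respect to
    mu. *)
Lemma content_generalized_function (tau : set G -> R[i]) : content_on tau ->
  exists xi : generalized_function R G, forall (m : smooth_measure R G) l,
    represents (smooth_val m) l -> xi m = step_integral tau l.
Proof.
move=> ctau.
pose xi0 (m : smooth_measure R G) : R[i]^o :=
  step_integral tau (xget [::] [set l | represents (smooth_val m) l]).
have xi0E (m : smooth_measure R G) l : represents (smooth_val m) l ->
    xi0 m = step_integral tau l.
  move=> ml; apply: (represents_unique ctau _ ml).
  exact: (@xgetPex _ [::] [set l | represents (smooth_val m) l]) (ex_intro _ l ml).
have repr_ex (m : smooth_measure R G) : exists l, represents (smooth_val m) l.
  by apply: represents_exists; apply/asboolP; case: m.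
have lin : linear xi0.
  move=> a u v; have [l ul] := repr_ex u; have [l' vl'] := repr_ex v.
  rewrite (xi0E u l)// (xi0E v l')//.
  rewrite (xi0E _ ([seq (a * p.1, p.2) | p <- l] ++ l')) ?step_integral_linear//.
  exact: represents_linear.
by exists (HB.pack_for (generalized_function R G) xi0
  (GRing.isLinear.Build _ _ _ _ xi0 lin)).
Qed.

Let biinvariant_vol (a b : G) V : copen V ->
  vol mu [set x | V (a * x * b)%g] = vol mu V.
Proof.
move=> cV; rewrite /vol; have [_ _ lmu] := hmu.
rewrite -(rmu b (copen_measurable cV)).
have cVb : copen [set x | V (x * b)%g].
  have := copen_translate 1%g b cV; congr copen.
  by apply/seteqP; split=> x /=; rewrite mul1g.
by rewrite -(lmu a _ (copen_measurable cVb)).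
Qed.

(** Translation carries the coset y V to a coset of a conjugate of V, which has
    the same volume because mu is invariant on both sides. *)
Lemma represents_translate (h1 h2 : G) (m : smooth_measure R G) l :
  represents (smooth_val m) l ->
  represents (smooth_val (translate h1 h2 m))
    [seq (p.1, [set x | p.2 (h1^-1 * x * h2)%g]) | p <- l].
Proof.
move=> [cl [V0 [sV0 cV0] ml]]; split=> [p /mapP[q /cl cq ->]|].
  exact: copen_translate.
exists [set x | V0 (h2^-1 * x * h2)%g].
  split; last exact: copen_translate.
  have := subgroup_translate h2^-1%g sV0; congr subgroup.
  by rewrite invgK.
move=> V [sV cV] VV0 y A AE.
pose V' := [set x | V (h2 * x * h2^-1)%g].
have cV' : cosubgroup V' by split; [exact: subgroup_translate|exact: copen_translate].
rewrite -(biinvariant_vol h2 h2^-1%g cV).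
have -> : step [seq (p.1, [set x | p.2 (h1^-1 * x * h2)%g]) | p <- l] y =
    step l (h1^-1 * y * h2)%g.
  rewrite /step big_map; apply: eq_bigr => p _ /=; congr (_ * _).
apply: (ml V' cV') => [x /VV0 /=|].
  by rewrite !mulgA mulVg mul1g mulgVK.
rewrite /= AE; apply/seteqP; split=> x /=; rewrite /lcoset /V' /=;
  by rewrite !invgM !invgK !mulgA mulgV mul1g.
Qed.

Lemma content_generalized_function_biinvariant (H : groupClosed G)
    (tau : set G -> R[i]) (xi : generalized_function R G) :
  (forall (m : smooth_measure R G) l, represents (smooth_val m) l ->
    xi m = step_integral tau l) ->
  (forall h1 h2 K, h1 \in H -> h2 \in H -> copen K ->
    tau [set x | K (h1 * x * h2)%g] = tau K) -> biinvariant H xi.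
Proof.
move=> xiE tauH h1 h2 h1H h2H m.
have [l ml] : exists l, represents (smooth_val m) l.
  by apply: represents_exists; apply/asboolP; case: m.
rewrite (xiE _ _ (represents_translate h1 h2 ml)) (xiE _ _ ml).
rewrite /step_integral big_map big_seq [RHS]big_seq; apply: eq_bigr => p pl /=.
by rewrite tauH ?gpredV//; case: ml => cl _; exact: cl.
Qed.

Lemma test_function_indic K : copen K -> test_function (\1_K : G -> R[i]).
Proof.
move=> cK; split=> [x|]; last first.
  apply: (subclosed_compact _ cK.1); first exact: closed_closure.
  have clK : closed K by exact: compact_closed cK.1.
  rewrite [X in _ `<=` X](closure_id K).1//; apply: closure_subset => x /=.
  by rewrite indicE; case: (boolP (x \in K)) => [/set_mem//|]; rewrite eqxx.
have [V [sV cV] VK] := copen_right_stable hG sG cK.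
have : nbhs x (lcoset x V).
  apply: open_nbhs_nbhs; split; last exact: cong_refl.
  by have [] := copen_lcoset x cV.
by apply: filterS => y xy; rewrite !indicE (right_stable_eq sV VK xy).
Qed.

Lemma represents_indic K (nu : {measure set (borel G) -> \bar R}) (c : R[i]) :
  copen K -> (forall L, copen L -> vol nu L = c * vol mu L) ->
  represents (density \1_K nu) [:: (c, K)].
Proof.
move=> cK volE; split=> [p|]; first by rewrite inE => /eqP ->.
have [V0 cV0 V0K] := copen_right_stable hG sG cK.
exists V0 => // V cV VV0 x A AE.
rewrite (density_lcoset _ AE) => [|y /VV0 xy]; last first.
  by rewrite !indicE (right_stable_eq cV0.1 V0K xy).
rewrite volE; last exact: copen_lcoset cV.2.
rewrite /vol left_invariant_lcoset; [|by case: hmu|exact: copen_measurable cV.2].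
by rewrite /step big_seq1/= indicE mulrA [c * _]mulrC.
Qed.

End content_to_generalized_function.

(** The hypothesis is applied to the generalized function of tau and to the
    measure \1_K mu. Its image under sigma is the indicator of sigma K times the
    image of mu, a Haar measure, and c is the ratio of the latter to mu. *)
Theorem anti_invariant_content (R : realType) (G : topologicalGroupType)
    (H : groupClosed G) (sigma : anti_involution G) :
  hausdorff_space G -> small_cosubgroups G -> unimodular R G ->
  (forall xi : generalized_function R G,
    biinvariant H xi -> anti_gen_fun sigma xi =1 xi) ->
  exists c : R[i], forall tau : set G -> R[i], content_on tau ->
    (forall h1 h2 K, h1 \in H -> h2 \in H -> copen K ->
      tau [set x | K (h1 * x * h2)%g] = tau K) ->
    forall K, copen K -> tau K = c * tau [set x | K (sigma x)].
Proof.
move=> hG sG [mu [hmu rmu]] sinv.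
pose cs := anti_continuous sigma; have sK := antiK sigma.
have hpush : haar (push cs mu).
  apply: (haar_push_anti _ cs sK sK (tau := sigma)); last by left.
  - by move=> g x; rewrite antiM sK.
  - by move=> g x; rewrite antiM sK.
have [c volE] := haar_vol_proportional hG sG hpush hmu rmu.
exists c => tau ctau tauH K cK.
have [xi xiE] := content_generalized_function hG sG hmu rmu ctau.
have xiH := content_generalized_function_biinvariant hG sG hmu rmu xiE tauH.
have tK := test_function_indic R hG sG cK.
have smK : density (\1_K : G -> R[i]) mu \in @smooth_pred R G.
  apply/asboolP; exists 1%N, (fun=> 1), (fun=> \1_K), (fun=> mu); split.
    by move=> _; split=> //; left.
  by rewrite big_ord1 scale1r.
pose m : smooth_measure R G := SmoothMeasure smK.
have cK' : copen [set x | K (sigma x)] by exact: (copen_preimage cs cs sK sK).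
have xim : xi m = tau K.
  rewrite (xiE m [:: (1, K)]); first by rewrite /step_integral big_seq1 mul1r.
  by apply: represents_indic => // L _; rewrite mul1r.
rewrite -xim -(sinv xi xiH m) /anti_gen_fun/=.
rewrite (xiE _ [:: (c, [set x | K (sigma x)])]).
  by rewrite /step_integral big_seq1.
have -> : smooth_val (anti_pushforward sigma m) =
    density (\1_[set x | K (sigma x)]) (push cs mu).
  apply/funext => A /=.
  exact: (density_pushforward cs cs sK mu A tK).
exact: represents_indic.
Qed.

(** * Averaging along H *)

Section averaging.
Variables (R : realType) (G : topologicalGroupType) (H : groupClosed G).
Hypotheses (hG : hausdorff_space G) (clH : closed [set` H]).
Implicit Types (K L V U : set G) (x y z g : G) (f : ind R H).
Local Notation Hsub := (subgroup_type H).

Lemma hausdorff_subgroup : hausdorff_space Hsub.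
Proof.
move=> p q pq; apply: val_inj; apply: hG => A B nA nB.
have cval := @val_subgroup_continuous G H.
have [z [Az Bz]] := pq _ _ (cval p A nA) (cval q B nB).
by exists (val z).
Qed.

(** A cluster point in G of a filter on H lies in H, because H is closed. *)
Lemma compact_subgroup_preimage K : compact K ->
  compact ((val : Hsub -> G) @^-1` K).
Proof.
move=> cK F FF FK.
have [x [Kx Fx]] := cK (val @ F) _ FK.
have xH : x \in H.
  apply: (clH (t := x)) => B nB.
  have [|y [Hy By]] := Fx [set` H] B _ nB; last by exists y.
  have : F (val @^-1` [set` H]) by apply: filterS FK => h _; exact: (valP h).
  by [].
exists (Sub x xH : Hsub); split=> // A B FA [_ [[P oP <-] Px PB]].
have [|_ [[h Ah <-] Ph]] := Fx (val @` A) P _ (open_nbhs_nbhs (conj oP Px)).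
  have : F (val @^-1` (val @` A)) by apply: filterS FA => h Ah; exists h.
  by [].
by exists h; split=> //; exact: PB.
Qed.

Definition fiber K g : set Hsub := [set h | K (val h * g)%g].

Lemma copen_fiber K g : copen K -> copen (fiber K g).
Proof.
move=> cK; have [cKg oKg] := copen_translate 1%g g cK.
have -> : fiber K g = (val : Hsub -> G) @^-1` [set x | K (1 * x * g)%g].
  by apply/seteqP; split=> h; rewrite /fiber/= mul1g.
split; first exact: compact_subgroup_preimage.
by move/continuousP: (@val_subgroup_continuous G H); exact.
Qed.

Variable lam : {measure set (borel Hsub) -> \bar R}.
Hypotheses (hlam : left_haar lam) (rlam : right_invariant lam).

Definition avg_fun K : G -> R[i]^o := fun g => vol lam (fiber K g).

Lemma avg_funMl K h g : copen K -> h \in H -> avg_fun K (h * g)%g = avg_fun K g.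
Proof.
move=> cK hH; rewrite /avg_fun /vol.
rewrite -[in RHS](rlam (Sub h hH : Hsub) (copen_measurable (copen_fiber g cK))).
by congr (fine (lam _))%:C%C; apply/seteqP; split=> k; rewrite /fiber/= mulgA.
Qed.

Lemma avg_fun_right_stable K V g v : subgroup V -> right_stable V K -> V v ->
  avg_fun K (g * v)%g = avg_fun K g.
Proof.
move=> sV VK Vv; congr (vol lam _); apply/seteqP; split=> h; rewrite /fiber/=.
  apply: VK; rewrite !invgM -!mulgA mulKg mulVg mulg1.
  exact: subgroupV.
by apply: VK; rewrite [(_ * (g * v))%g]mulgA mulKg.
Qed.

Lemma avg_fun_eq0 K g : (forall h, h \in H -> ~ K (h * g)%g) -> avg_fun K g = 0.
Proof.
move=> Kg; rewrite /avg_fun /vol (_ : fiber K g = set0) ?measure0//.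
by apply/seteqP; split=> // h Kh; apply: (Kg (val h)) => //; exact: valP.
Qed.

Hypothesis sG : small_cosubgroups G.

Lemma subgroup_group_closed V : subgroup V -> group_closed (mem V : {pred G}).
Proof.
move=> sV; split; first by apply: mem_set; exact: sV.1.
move=> x y /set_mem Vx /set_mem Vy; apply: mem_set.
by apply: subgroupM => //; exact: subgroupV.
Qed.

Lemma avg_fun_ind K : copen K -> avg_fun K \in @ind_pred R G H.
Proof.
move=> cK; apply/asboolP; split.
- by move=> h g hH; exact: avg_funMl.
- have [V [sV cV] VK] := copen_right_stable hG sG cK.
  exists (group_closed_pack (subgroup_group_closed sV)).
    rewrite (_ : [set` _] = V); first by case: cV.
    by apply/seteqP; split=> x; [exact: set_mem|exact: mem_set].
  by move=> u g /set_mem Vu; exact: avg_fun_right_stable VK Vu.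
- exists K; first exact: cK.1.
  move=> g; apply: contraNP => nKg; apply/eqP/avg_fun_eq0 => h hH Kh.
  apply: nKg; exists h^-1%g, (h * g)%g; split=> //; first by rewrite gpredV.
  by rewrite mulKg.
Qed.

(** The image of the indicator function of K under integration along H; the
    default value 0 is taken only when K is not compact open. *)
Definition avg K : ind R H := insubd 0 (avg_fun K).

Lemma avgE K : copen K -> avg K = avg_fun K :> (G -> R[i]^o).
Proof. by move=> cK; rewrite /avg; exact: (insubdK 0 (avg_fun_ind cK)). Qed.

Lemma ind_ext f f' : f =1 f' -> f = f'.
Proof. by move=> ff'; apply: val_inj; exact/funext. Qed.

Lemma avgU K L : copen K -> copen L -> K `&` L = set0 ->
  avg (K `|` L) = avg K + avg L.
Proof.
move=> cK cL KL; apply: ind_ext => g.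
rewrite -[RHS]/(avg K g + avg L g) avgE; last exact: copenU.
rewrite !avgE// /avg_fun.
have fin C : compact C -> (lam C < +oo)%E by have [[+ _ _] _ _] := hlam; exact.
rewrite -(vol_content fin); [|exact: copen_fiber..|]; first by [].
by apply/seteqP; split=> // h [Kh Lh]; suff : set0 (val h * g)%g by []; rewrite -KL.
Qed.

Lemma avg_translate K h b : copen K -> h \in H ->
  avg [set x | K (h * x * b)%g] = ind_act b (avg K).
Proof.
move=> cK hH; apply: ind_ext => g; rewrite /ind_act/=.
rewrite !avgE//; last exact: copen_translate.
have [_ _ llam] := hlam; rewrite /avg_fun /vol.
rewrite -[in RHS](llam (Sub h hH : Hsub) _
  (copen_measurable (copen_fiber (g * b)%g cK))).
by congr (fine (lam _))%:C%C; apply/seteqP; split=> k; rewrite /fiber/= !mulgA.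
Qed.

Section coefficient.
Variable T : {linear ind R H -> ind R H}.
Hypothesis TH : hecke_algebra T.

(** Evaluation at 1 loses nothing: by equivariance the values of T (avg K) at all
    points are values of this content, on translates of K. *)
Definition hecke_content K : R[i] := T (avg K) 1%g.

Lemma hecke_content_on : content_on hecke_content.
Proof.
by move=> K L cK cL KL; rewrite /hecke_content avgU// linearD.
Qed.

Lemma hecke_content_translate K h b : copen K -> h \in H ->
  hecke_content [set x | K (h * x * b)%g] = T (avg K) b.
Proof.
by move=> cK hH; rewrite /hecke_content avg_translate// TH /ind_act/= mul1g.
Qed.

Lemma hecke_content_biinvariant h1 h2 K : h1 \in H -> h2 \in H -> copen K ->
  hecke_content [set x | K (h1 * x * h2)%g] = hecke_content K.
Proof.
move=> h1H h2H cK; rewrite hecke_content_translate//.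
by have [TK _ _] := indP (T (avg K)); rewrite -[h2]mulg1 TK.
Qed.

End coefficient.

(** The function avg (lcoset a U) is a nonzero multiple of the indicator function
    of H a U, so subtracting a multiple of it from f removes this double coset from
    the support, which consists of finitely many of them. *)
Lemma ind_span_avg U f : cosubgroup U ->
  (forall u g, U u -> f (g * u)%g = f g) ->
  exists l : seq (R[i] * G), f = \sum_(p <- l) p.1 *: avg (lcoset p.2 U).
Proof.
move=> cU fU; have [sU cU'] := cU.
have ccoset a := copen_lcoset a cU'.
have [fH _ [C cC fC]] := indP f.
have [s sC] := compact_translates cC cU'.2 sU.1.
have {fC C cC sC} : forall g, f g != 0 ->
    exists2 y, y \in s & exists2 h, h \in H & U (y^-1 * (h * g))%g.
  move=> g /fC[h [c [hH /sC[y ys yc] ->]]]; exists y => //.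
  by exists h^-1%g; [rewrite gpredV|rewrite mulKg].
elim: s f fH fU => [|a s IH] f fH fU fs.
  exists [::]; rewrite big_nil; apply: ind_ext => g.
  by have [//|/fs[]] := eqVneq (f g) 0.
have aa : avg (lcoset a U) a != 0.
  rewrite avgE// /avg_fun /vol fmorph_eq0 fine_eq0.
    apply: left_haar_neq0 => //; first exact: hausdorff_subgroup.
      by have [] := copen_fiber a (ccoset a).
    by rewrite /fiber/= mul1g; exact: cong_refl.
  have [[flam _ _] _ _] := hlam; rewrite ge0_fin_numE//; apply: flam.
  by have [] := copen_fiber a (ccoset a).
pose b := f a / avg (lcoset a U) a.
have E g : (f - b *: avg (lcoset a U)) g = f g - b * avg (lcoset a U) g by [].
have aU u g : U u -> avg (lcoset a U) (g * u)%g = avg (lcoset a U) g.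
  move=> Uu; rewrite !avgE//.
  by apply: avg_fun_right_stable Uu => //; exact: right_stable_lcoset.
have aH h g : h \in H -> avg (lcoset a U) (h * g)%g = avg (lcoset a U) g.
  by move=> hH; rewrite !avgE// avg_funMl.
have [| |g|l fl] := IH (f - b *: avg (lcoset a U)).
- by move=> h g hH; rewrite !E fH// aH.
- by move=> u g Uu; rewrite !E fU// aU.
- rewrite E.
  have [[h hH ahg]|nhg] := pselect (exists2 h, h \in H & U (a^-1 * (h * g))%g).
    rewrite -(fH h)// -(aH h)// -[(h * g)%g](mulVKg a) fU// aU//.
    by rewrite /b mulfVK// subrr eqxx.
  rewrite avgE// avg_fun_eq0 ?mulr0 ?subr0; last first.
    by move=> h hH ahg; apply: nhg; exists h.
  move=> /fs[y]; rewrite inE => /predU1P[->//|ys yg]; by exists y.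
exists ((b, a) :: l); rewrite big_cons -fl /=.
by rewrite addrC subrK.
Qed.

End averaging.

(** * Commutativity of the Hecke algebra *)

Section commutativity.
Variables (R : realType) (G : topologicalGroupType) (H : groupClosed G).
Hypotheses (hG : hausdorff_space G) (clH : closed [set` H]).
Hypothesis sG : small_cosubgroups G.
Variable lam : {measure set (borel (subgroup_type H)) -> \bar R}.
Hypotheses (hlam : left_haar lam) (rlam : right_invariant lam).
Variables (sigma : anti_involution G) (c : R[i]).
Hypothesis sigma_content : forall tau : set G -> R[i], content_on tau ->
  (forall h1 h2 K, h1 \in H -> h2 \in H -> copen K ->
    tau [set x | K (h1 * x * h2)%g] = tau K) ->
  forall K, copen K -> tau K = c * tau [set x | K (sigma x)].

Lemma anti_involution1 : sigma 1%g = 1%g.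
Proof. by apply: (mulgI (sigma 1%g)); rewrite -antiM !mulg1. Qed.

Lemma anti_involutionV x : sigma x^-1%g = (sigma x)^-1%g.
Proof.
by apply: (mulgI (sigma x)); rewrite mulgV -antiM mulVg anti_involution1.
Qed.

Definition theta (x : G) : G := (sigma x)^-1%g.

Lemma thetaK : involutive theta.
Proof. by move=> x; rewrite /theta anti_involutionV invgK antiK. Qed.

Lemma sigma_stable_cosubgroup (W : set G) : nbhs 1%g W -> exists U,
  [/\ cosubgroup U, U `<=` W & forall x, U (sigma x) <-> U x].
Proof.
move=> nW; have [V [sV cV] VW] := sG nW.
have cs := anti_continuous sigma; have sK := antiK sigma.
exists (V `&` [set x | V (sigma x)]); split.
- apply: cosubgroupI => //; split; last exact: (copen_preimage cs cs sK sK).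
  split=> [|x y Vx Vy] /=; first by rewrite anti_involution1; exact: sV.1.
  rewrite antiM anti_involutionV; apply: subgroupM => //; exact: subgroupV.
- by move=> x [/VW].
- by move=> x /=; rewrite sK; split=> -[].
Qed.

Local Notation A U y := (avg lam (lcoset y U)).

(** The two sides are, up to c, the values of the content of T on y U x^-1 and on
    its image theta x U (theta y)^-1 under sigma. *)
Lemma coefficient_symmetry (T : {linear ind R H -> ind R H}) U x y :
  hecke_algebra T -> cosubgroup U -> (forall x, U (sigma x) <-> U x) ->
  T (A U y) x = c * T (A U (theta x)) (theta y).
Proof.
move=> TH [sU cU] sigmaU.
have H1 : 1%g \in H by exact: gpred1.
have ccoset a := copen_lcoset a cU.
have cT := hecke_content_on hG clH hlam rlam sG T.
have HT h1 h2 K := @hecke_content_biinvariant _ _ _ hG clH _ hlam rlam sG _ TH h1 h2 K.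
have E a b : T (A U a) b =
    hecke_content lam T [set g | lcoset a U (1 * g * b)%g].
  exact/esym/(hecke_content_translate hG clH hlam rlam sG TH b (ccoset a) H1).
rewrite !E (sigma_content cT HT); last exact: copen_translate.
congr (_ * hecke_content _ _ _); apply/seteqP; split=> g; rewrite /lcoset/theta/=;
  rewrite !mul1g ?invgK -anti_involutionV -{1}(antiK sigma g) => Ug;
  by apply/sigmaU; rewrite !antiM ?antiK mulgA in Ug *.
Qed.

(** Expanding S (A U z) and T (A U (theta x)) in averaged cosets turns both
    sides into the same double sum of products of matrix coefficients. *)
Lemma hecke_comm_avg (S T : {linear ind R H -> ind R H}) U z :
  hecke_algebra S -> hecke_algebra T -> cosubgroup U ->
  (forall x, U (sigma x) <-> U x) -> T (S (A U z)) = S (T (A U z)).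
Proof.
move=> SH TH cU sigmaU; have [sU cU'] := cU.
have H1 : 1%g \in H by exact: gpred1.
have AU (P : {linear ind R H -> ind R H}) y u g : hecke_algebra P -> U u ->
    P (A U y) (g * u)%g = P (A U y) g.
  move=> PH Uu; rewrite -[LHS]/(ind_act u (P (A U y)) g) -PH.
  rewrite -(avg_translate hG clH hlam rlam sG u (copen_lcoset y cU') H1).
  congr (P (avg _ _) g); apply/seteqP; split=> t; rewrite /lcoset/= mul1g mulgA.
    by move=> /(subgroupM sU) /(_ (subgroupV sU Uu)); rewrite mulgK.
  by move=> ytU; exact: subgroupM.
have expand (P : {linear ind R H -> ind R H}) y : hecke_algebra P ->
    exists l, P (A U y) = \sum_(p <- l) p.1 *: A U p.2.
  by move=> PH; apply: (ind_span_avg hG clH hlam rlam sG cU) => u g; exact: AU.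
have sumE l (P : {linear ind R H -> ind R H}) x :
    P (\sum_(p <- l) p.1 *: A U p.2) x = \sum_(p <- l) p.1 * P (A U p.2) x.
  rewrite linear_sum; elim: l => [|p l IH]; first by rewrite !big_nil.
  by rewrite !big_cons linearZ/= -IH.
apply: ind_ext => x.
have [l lE] := expand S z SH; have [k kE] := expand T (theta x) TH.
have STH : hecke_algebra (S \o T : {linear ind R H -> ind R H}).
  by move=> g f /=; rewrite TH SH.
have idH : hecke_algebra (idfun : {linear ind R H -> ind R H}) by [].
have sym P y t (PH : hecke_algebra P) := @coefficient_symmetry P U t y PH cU sigmaU.
rewrite [RHS](sym (S \o T) _ _ STH)/= kE sumE lE sumE.
transitivity (\sum_(p <- l) \sum_(q <- k) p.1 * (q.1 * A U p.2 (theta q.2))).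
  apply: eq_bigr => p _; rewrite (sym T)// kE (sumE _ idfun) -mulr_sumr.
  congr (_ * _); rewrite mulr_sumr; apply: eq_bigr => q _.
  by have := sym idfun p.2 (theta q.2) idH; rewrite thetaK /= => ->; rewrite mulrCA.
rewrite exchange_big mulr_sumr; apply: eq_bigr => q _ /=.
have := sym S z (theta q.2) SH; rewrite thetaK lE (sumE _ idfun)/= mulrCA => <-.
by rewrite mulr_sumr; apply: eq_bigr => p _; rewrite mulrCA.
Qed.

Lemma hecke_commutative_of_content : hecke_commutative R H.
Proof.
move=> S T SH TH f /=.
have [_ [V oV VU] _] := indP f.
have [|U [cU UV sigmaU]] := sigma_stable_cosubgroup (W := [set` V]).
  by apply: open_nbhs_nbhs; split=> //; exact: gpred1.
have [|l ->] := ind_span_avg hG clH hlam rlam sG cU (f := f).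
  by move=> u g /UV; exact: VU.
rewrite !linear_sum; apply: eq_bigr => p _; rewrite !linearZ; congr (_ *: _).
exact: hecke_comm_avg.
Qed.

End commutativity.

Theorem theoremA (R : realType) (G : topologicalGroupType) (H : groupClosed G) :
  locally_compact [set: G] ->
  totally_disconnected [set: G] ->
  hausdorff_space G ->
  closed [set` H] ->
  unimodular R G ->
  unimodular R (subgroup_type H) ->
  (exists sigma : anti_involution G,
    sigma @` [set` H] = [set` H] /\
    forall xi : generalized_function R G,
      biinvariant H xi -> anti_gen_fun sigma xi =1 xi) ->
  hecke_commutative R H.
Proof.
move=> lcG tdG hG clH uG [lam [hlam rlam]] [sigma [_ sigma_xi]].
have sG : small_cosubgroups G by move=> W; exact: van_dantzig.
have [c cE] := anti_invariant_content hG sG uG sigma_xi.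
exact: (hecke_commutative_of_content hG clH sG hlam rlam cE).
Qed.
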